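(* Let $M$ be a smooth oriented manifold of dimension $n\geq 2$ and let $\nabla_a$ be a special torsion-free connection on $TM$, with Schouten tensor $\mathrm{P}_{ab}$, Weyl curvature $W_{ab}{}^c{}_d$ and Cotton-York tensor $Y_{abc}$. Endow the vector bundle $\mathcal{T}=\bigodot^2TM\oplus TM\oplus\mathbb{R}$ with the connection $$\begin{pmatrix}\sigma^{bc}\\ \mu^b\\ \rho\end{pmatrix}\longmapsto\begin{pmatrix}\nabla_a\sigma^{bc}-\delta_a{}^b\mu^c-\delta_a{}^c\mu^b\\ \nabla_a\mu^b-\delta_a{}^b\rho+\mathrm{P}_{ac}\sigma^{bc}-\frac1n W_{ac}{}^b{}_d\sigma^{cd}\\ \nabla_a\rho+2\mathrm{P}_{ab}\mu^b-\frac4n Y_{abc}\sigma^{bc}\end{pmatrix}.$$ Then $(\sigma^{bc},\mu^b,\rho)\mapsto\sigma^{bc}$ is a one-to-one correspondence between covariant constant sections of $\mathcal{T}$ and symmetric contravariant $2$-tensors $\sigma^{bc}$ on $M$ satisfying $$\nabla_a\sigma^{bc}=\delta_a{}^b\mu^c+\delta_a{}^c\mu^b\quad\text{for some vector field }\mu^a.$$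
   Context: Abstract index notation is used: indices mark tensor type, repeated indices denote the natural pairing, and $\delta_a{}^b$ is the identity endomorphism. All objects are smooth. $\bigodot$ denotes symmetric tensor product and $\mathbb{R}$ the trivial line bundle. A torsion-free connection $\nabla$ is called special if there is a (nowhere vanishing) volume form $\epsilon_{bc\cdots d}$ on $M$ with $\nabla_a\epsilon_{bc\cdots d}=0$. Such a connection has symmetric Ricci tensor $R_{ab}$, where $(\nabla_b\nabla_a-\nabla_a\nabla_b)X^b=R_{ab}X^b$. Its Schouten tensor is the symmetric tensor $\mathrm{P}_{ab}=\frac{1}{n-1}R_{ab}$. Its (projective) Weyl curvature $W_{ab}{}^c{}_d$ is the totally trace-free tensor defined by $$(\nabla_a\nabla_b-\nabla_b\nabla_a)X^c=W_{ab}{}^c{}_dX^d+\delta_a{}^c\mathrm{P}_{bd}X^d-\delta_b{}^c\mathrm{P}_{ad}X^d,$$ and its Cotton-York tensor is $Y_{abc}=\frac12(\nabla_a\mathrm{P}_{bc}-\nabla_b\mathrm{P}_{ac})$. *)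

(* Defs.v *)
From HB Require Import structures.
From mathcomp Require Import all_boot all_order all_algebra all_fingroup.
From mathcomp Require Import all_classical all_reals all_analysis.

Set Implicit Arguments.
Unset Strict Implicit.
Unset Printing Implicit Defensive.

Import Order.TTheory GRing.Theory Num.Theory.
Import numFieldNormedType.Exports.

Local Open Scope classical_set_scope.
Local Open Scope ring_scope.

Section smooth_functions.
Variables (R : realType) (n : nat).

Definition basis_vec (j : 'I_n) : 'rV[R]_n := delta_mx 0 j.

Fixpoint Ck_on (k : nat) (U : set 'rV[R]_n) (f : 'rV[R]_n -> R) : Prop :=
  (forall x, U x -> {for x, continuous f}) /\
  (if k is k'.+1 then forall j : 'I_n,
     (forall x, U x -> derivable f x (basis_vec j)) /\
     Ck_on k' U (fun x => 'D_(basis_vec j) f x)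
   else True).

Definition smooth_on (U : set 'rV[R]_n) (f : 'rV[R]_n -> R) : Prop :=
  forall k, Ck_on k U f.

End smooth_functions.

(* A smooth structure is given by an atlas, which need not be maximal, and an
   orientation by the positivity of its transition Jacobians.  The map
   [icoord i] is meaningful only on the image of the chart [i]. *)
Record oriented_manifold (R : realType) (n : nat) := OrientedManifold {
  carrier :> topologicalType ;
  chart : Type ;
  dom : chart -> set carrier ;
  coord : chart -> carrier -> 'rV[R]_n ;
  icoord : chart -> 'rV[R]_n -> carrier ;
  carrier_hausdorff : hausdorff_space carrier ;
  carrier_second_countable : @second_countable carrier ;
  dom_cover : forall p, exists i, dom i p ;
  dom_open : forall i, open (dom i) ;
  image_open : forall i, open (coord i @` dom i) ;
  coordK : forall i p, dom i p -> icoord i (coord i p) = p ;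
  coord_continuous : forall i p, dom i p -> {for p, continuous (coord i)} ;
  icoord_continuous : forall i p, dom i p ->
    {for coord i p, continuous (icoord i)} ;
  transition_smooth : forall i j (a : 'I_n),
    smooth_on (coord i @` (dom i `&` dom j))
              (fun x => coord j (icoord i x) 0 a) ;
  transition_oriented : forall i j p, dom i p -> dom j p ->
    0 < \det (\matrix_(a < n, b < n)
      'D_(basis_vec R b) (fun x => coord j (icoord i x) 0 a) (coord i p))
}.

Section calculus.
Variables (R : realType) (n : nat) (M : oriented_manifold R n).
Implicit Types (i j : chart M) (p q : nat) (x : M) (a b c d : 'I_n).

(* The coordinate function x^a of the chart [i]. *)
Definition xcoord i a : M -> R := fun x => coord i x 0 a.

(* The partial derivative in the direction of the [a]-th coordinate of [i]. *)
Definition partial i a (f : M -> R) : M -> R :=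
  fun x => 'D_(basis_vec R a) (f \o icoord i) (coord i x).

Definition smooth_in_chart i (f : M -> R) : Prop :=
  smooth_on (coord i @` dom i) (f \o icoord i).

Definition smooth_function (f : M -> R) : Prop :=
  forall i, smooth_in_chart i f.

(* Components, in a single chart, of a tensor field with [p] upper indices
   (first tuple) and [q] lower indices (second tuple). *)
Definition components p q := M -> p.-tuple 'I_n -> q.-tuple 'I_n -> R.

Definition smooth_components i p q (T : components p q) : Prop :=
  forall u v, smooth_in_chart i (fun x => T x u v).

Definition tensor p q := chart M -> components p q.

(* Components carry no information outside the domain of their chart; they are
   set to 0 there, so that equal tensor fields are equal as functions. *)
Definition tensor_field p q (T : tensor p q) : Prop :=
  [/\ forall i, smooth_components i (T i),
      forall i j x, dom i x -> dom j x -> forall u v,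
        T j x u v =
        \sum_(u' : p.-tuple 'I_n) \sum_(v' : q.-tuple 'I_n)
          (\prod_(k < p) partial i (tnth u' k) (xcoord j (tnth u k)) x) *
          (\prod_(k < q) partial j (tnth v k) (xcoord i (tnth v' k)) x) *
          T i x u' v'
    & forall i x, ~ dom i x -> forall u v, T i x u v = 0].

(* A connection on the tangent bundle, given in each chart by its Christoffel
   symbols: nabla_a X^c = d_a X^c + (christoffel i x a b c) X^b. *)
Record connection := Connection {
  christoffel : chart M -> M -> 'I_n -> 'I_n -> 'I_n -> R ;
  christoffel_smooth : forall i a b c,
    smooth_in_chart i (fun x => christoffel i x a b c) ;
  christoffel_transform : forall i j x, dom i x -> dom j x -> forall a b c,
    christoffel j x a b c =
    \sum_(f < n) partial i f (xcoord j c) x *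
      (\sum_(d < n) \sum_(e < n)
         partial j a (xcoord i d) x * partial j b (xcoord i e) x *
         christoffel i x d e f
       + partial j a (partial j b (xcoord i f)) x)
}.

Variable D : connection.

Definition torsion_free : Prop := forall i x, dom i x ->
  forall a b c, christoffel D i x a b c = christoffel D i x b a c.

Definition replace_index p (u : p.-tuple 'I_n) (k : 'I_p) d : p.-tuple 'I_n :=
  [tuple if l == k then d else tnth u l | l < p].

(* The covariant derivative in the chart [i]; the new lower index is the first
   one, so that nabla (nabla X) at the lower indices a, b is
   nabla_a nabla_b X. *)
Definition nabla i p q (T : components p q) : components p q.+1 :=
  fun x u v =>
    let a := thead v in
    let w : q.-tuple 'I_n := [tuple of behead v] in
    partial i a (fun y => T y u w) x
    + \sum_(k < p) \sum_(d < n)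
        christoffel D i x a d (tnth u k) * T x (replace_index u k d) w
    - \sum_(k < q) \sum_(d < n)
        christoffel D i x a (tnth w k) d * T x u (replace_index w k d).

Definition volume_form (eps : tensor 0 n) : Prop :=
  [/\ tensor_field eps,
      forall i x, dom i x -> forall (v : n.-tuple 'I_n) (s : 'S_n),
        eps i x [tuple] [tuple tnth v (s k) | k < n] =
        (-1) ^+ s * eps i x [tuple] v
    & forall i x, dom i x -> exists v, eps i x [tuple] v != 0].

Definition special : Prop := exists eps : tensor 0 n,
  volume_form eps /\
  forall i x, dom i x -> forall v, nabla i (eps i) x [tuple] v = 0.

(* In the following two definitions the vector field [X] ranges over the
   sections of TM over the domain of a chart, that is, over the smooth
   component functions in that chart. *)
Definition is_ricci (Ric : tensor 0 2) : Prop :=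
  tensor_field Ric /\
  forall i (X : components 1 0), smooth_components i X ->
  forall x, dom i x -> forall a,
    \sum_(b < n) (nabla i (nabla i X) x [tuple b] [tuple b; a]
                  - nabla i (nabla i X) x [tuple b] [tuple a; b])
    = \sum_(b < n) Ric i x [tuple] [tuple a; b] * X x [tuple b] [tuple].

Definition is_schouten (P : tensor 0 2) : Prop :=
  exists2 Ric, is_ricci Ric &
    forall i x u v, P i x u v = (n%:R - 1)^-1 * Ric i x u v.

Definition delta a b : R := (a == b)%:R.

(* W_{ab}^c_d is [W i x [tuple c] [tuple a; b; d]]; that [W] is totally
   trace-free follows from the defining equation when [P] is the Schouten
   tensor of a special torsion-free connection. *)
Definition is_weyl (P : tensor 0 2) (W : tensor 1 3) : Prop :=
  tensor_field W /\
  forall i (X : components 1 0), smooth_components i X ->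
  forall x, dom i x -> forall a b c,
    nabla i (nabla i X) x [tuple c] [tuple a; b]
    - nabla i (nabla i X) x [tuple c] [tuple b; a]
    = \sum_(d < n) W i x [tuple c] [tuple a; b; d] * X x [tuple d] [tuple]
      + delta a c *
        (\sum_(d < n) P i x [tuple] [tuple b; d] * X x [tuple d] [tuple])
      - delta b c *
        (\sum_(d < n) P i x [tuple] [tuple a; d] * X x [tuple d] [tuple]).

Definition cotton_york (P : tensor 0 2) i x a b c : R :=
  2^-1 * (nabla i (P i) x [tuple] [tuple a; b; c]
          - nabla i (P i) x [tuple] [tuple b; a; c]).

Definition symmetric_bivector (sigma : tensor 2 0) : Prop :=
  tensor_field sigma /\
  forall i x, dom i x -> forall b c,
    sigma i x [tuple b; c] [tuple] = sigma i x [tuple c; b] [tuple].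

Record tractor := Tractor {
  sigma_of : tensor 2 0 ;
  mu_of : tensor 1 0 ;
  rho_of : M -> R
}.

Definition tractor_section (s : tractor) : Prop :=
  [/\ symmetric_bivector (sigma_of s), tensor_field (mu_of s)
    & smooth_function (rho_of s)].

Section tractor_connection.
Variables (P : tensor 0 2) (W : tensor 1 3) (s : tractor).
Let sigma i x b c := sigma_of s i x [tuple b; c] [tuple].
Let mu i x b := mu_of s i x [tuple b] [tuple].

Definition tractor_nabla_sigma i x a b c : R :=
  nabla i (sigma_of s i) x [tuple b; c] [tuple a]
  - delta a b * mu i x c - delta a c * mu i x b.

Definition tractor_nabla_mu i x a b : R :=
  nabla i (mu_of s i) x [tuple b] [tuple a]
  - delta a b * rho_of s x
  + \sum_(c < n) P i x [tuple] [tuple a; c] * sigma i x b c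
  - n%:R^-1 * \sum_(c < n) \sum_(d < n)
      W i x [tuple b] [tuple a; c; d] * sigma i x c d.

Definition tractor_nabla_rho i x a : R :=
  partial i a (rho_of s) x
  + 2 * (\sum_(b < n) P i x [tuple] [tuple a; b] * mu i x b)
  - 4 / n%:R * \sum_(b < n) \sum_(c < n)
      cotton_york P i x a b c * sigma i x b c.

Definition covariant_constant : Prop := forall i x, dom i x ->
  [/\ forall a b c, tractor_nabla_sigma i x a b c = 0,
      forall a b, tractor_nabla_mu i x a b = 0
    & forall a, tractor_nabla_rho i x a = 0].

End tractor_connection.

Definition metrizability_equation (sigma : tensor 2 0) : Prop :=
  exists2 mu : tensor 1 0, tensor_field mu &
  forall i x, dom i x -> forall a b c,
    nabla i (sigma i) x [tuple b; c] [tuple a]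
    = delta a b * mu i x [tuple c] [tuple]
      + delta a c * mu i x [tuple b] [tuple].

End calculus.

Arguments tensor {R n} M p q.
Arguments tractor {R n} M.

(* Main.v *)
(* In a chart, put K_{ab}^c_d for the curvature and Ric = (n - 1) P.  Commuting
   derivatives in the metrizability equation and contracting gives
     n nabla_a mu^d = delta_a^d div(mu) - Ric_{ae} sigma^{de}
                      + K_{ab}^d_e sigma^{be},
   which is the second tractor equation with n rho = div(mu) + P_{bc} sigma^{bc}.
   Taking the divergence of this identity, and using the contracted second
   Bianchi identity, the symmetry of P and K_{ab}^c_c = 0 (the last two from the
   parallel volume form), gives d_a div(mu), hence the third equation.
   Conversely mu and rho are determined by sigma through traces of the first two
   equations.

   The identities of a chart are computed in the commutative ring of smooth
   functions on its domain, with the coordinate derivations.  That these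
   derivations commute follows from the defining equation of W: on the constant
   fields it identifies the curvature, and then on an arbitrary field X it leaves
   d_a d_b X - d_b d_a X = 0.  That rho does not depend on the chart is the
   chain rule, proved from the differentiability of C^1 functions. *)

Require Import Defs.
From HB Require Import structures.
From mathcomp Require Import all_boot all_order all_algebra all_fingroup.
From mathcomp Require Import all_classical all_reals all_analysis.
From mathcomp Require Import ring lra.
(* [dom] is shadowed by the Import of mathcomp. *)
Import Defs.

Set Implicit Arguments.
Unset Strict Implicit.
Unset Printing Implicit Defensive.
Import Order.TTheory GRing.Theory Num.Theory.
Import numFieldNormedType.Exports.
Local Open Scope classical_set_scope.
Local Open Scope ring_scope.

(** * Functions with continuous partial derivatives *)

Section smooth_on_theory.
Variables (R : realType) (n : nat).
Implicit Types (U : set 'rV[R]_n) (f g : 'rV[R]_n -> R).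
Local Notation e_ := (basis_vec R).

Lemma near_open_eq U f g x : open U -> (forall y, U y -> f y = g y) -> U x ->
  \forall y \near x, f y = g y.
Proof.
by move=> oU fg Ux; apply: filterS (open_nbhs_nbhs (conj oU Ux)) => y /fg.
Qed.

Lemma Ck_on_eq k U f g : open U -> (forall x, U x -> f x = g x) ->
  Ck_on k U f -> Ck_on k U g.
Proof.
move=> oU; elim: k f g => [|k IH] f g fg [cf df]; split.
- move=> x Ux; rewrite /prop_for /continuous_at -(fg x Ux).
  exact: cvg_trans (near_eq_cvg (near_open_eq oU fg Ux)) (cf x Ux).
- by [].
- move=> x Ux; rewrite /prop_for /continuous_at -(fg x Ux).
  exact: cvg_trans (near_eq_cvg (near_open_eq oU fg Ux)) (cf x Ux).
- move=> j; have [dj cj] := df j; split.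
    move=> x Ux; apply: near_eq_derivable (dj x Ux).
    exact: near_open_eq oU fg Ux.
  apply: IH cj => x Ux; apply: near_eq_derive.
  exact: near_open_eq oU fg Ux.
Qed.

Lemma Ck_onW k U f : Ck_on k.+1 U f -> Ck_on k U f.
Proof.
elim: k f => [|k IH] f [cf df]; split => // j.
by have [dj cj] := df j; split => //; exact: IH.
Qed.

Lemma Ck_on_cst k U (c : R) : open U -> Ck_on k U (fun=> c).
Proof.
have cc : forall c x, U x -> {for x, continuous (fun=> c : R)}.
  by move=> c' x _; exact: cst_continuous.
move=> oU; elim: k c => [|k IH] c; split; [exact: cc|by []|exact: cc|].
move=> j; split; first by move=> x _; exact: (derivable_cst c).
by apply: (Ck_on_eq oU _ (IH 0)) => x _; rewrite derive_cst.
Qed.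

Lemma Ck_onD k U f g : open U -> Ck_on k U f -> Ck_on k U g ->
  Ck_on k U (fun x => f x + g x).
Proof.
move=> oU; elim: k f g => [|k IH] f g [cf df] [cg dg]; split => //;
  try by move=> x Ux; exact: cvgD (cf x Ux) (cg x Ux).
move=> j; have [dfj cfj] := df j; have [dgj cgj] := dg j; split.
  by move=> x Ux; apply: derivableD; [exact: dfj|exact: dgj].
apply: (Ck_on_eq oU _ (IH _ _ cfj cgj)) => x Ux.
by rewrite [RHS]deriveD //; [exact: dfj|exact: dgj].
Qed.

Lemma Ck_onM k U f g : open U -> Ck_on k U f -> Ck_on k U g ->
  Ck_on k U (fun x => f x * g x).
Proof.
move=> oU; elim: k f g => [|k IH] f g Cf Cg; move: (Cf) (Cg) => [cf df] [cg dg];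
  split => //; try by move=> x Ux; exact: cvgM (cf x Ux) (cg x Ux).
move=> j; have [dfj cfj] := df j; have [dgj cgj] := dg j; split.
  by move=> x Ux; apply: derivableM; [exact: dfj|exact: dgj].
apply: (Ck_on_eq oU _
  (Ck_onD oU (IH _ _ (Ck_onW Cf) cgj) (IH _ _ (Ck_onW Cg) cfj))).
by move=> x Ux; rewrite [RHS]deriveM //; [exact: dfj|exact: dgj].
Qed.

Lemma smooth_on_eq U f g : open U -> (forall x, U x -> f x = g x) ->
  smooth_on U f -> smooth_on U g.
Proof. by move=> oU fg sf k; exact: Ck_on_eq fg (sf k). Qed.

Lemma smooth_on_derive U f j : smooth_on U f ->
  smooth_on U (fun x => 'D_(e_ j) f x).
Proof. by move=> sf k; have [_ /(_ j)[]] := sf k.+1. Qed.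

Lemma smooth_on_derivable U f j x : smooth_on U f -> U x ->
  derivable f x (e_ j).
Proof. by move=> sf Ux; have [_ /(_ j)[/(_ x Ux)]] := sf 1%N. Qed.

Lemma smooth_on_continuous U f x : smooth_on U f -> U x ->
  {for x, continuous f}.
Proof. by move=> sf Ux; have [/(_ x Ux)] := sf 0%N. Qed.

(** The difference quotients on both sides coincide. This reduces increments along a coordinate axis
    to functions of one real variable. *)
Lemma line_is_derive (V : normedModType R) (g : V -> R) (v q : V) (s : R) :
  derivable g (s *: v + q) v ->
  is_derive s 1 (fun t : R => g (t *: v + q)) ('D_v g (s *: v + q)).
Proof.
rewrite /derivable /derive => dg.
have E : (fun h : R => h^-1 *: (g (h *: v + (s *: v + q)) - g (s *: v + q)))
  = (fun h : R => h^-1 *: ((fun t : R => g (t *: v + q)) (h *: 1 + s)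
       - g (s *: v + q))).
  apply/funext => h /=; congr (_ *: (g _ - _)).
  by rewrite scaler1 scalerDl addrA.
split; first by rewrite /derivable -E.
by rewrite /derive -E.
Qed.

(** The usual mean value theorem on $[0,h]$ or $[h,0]$. Locating the intermediate point only by its
    absolute value treats both signs of [h] at once and suffices to keep it in a ball. *)
Lemma mean_value0 (f df : R -> R) (h : R) :
  (forall s : R, `|s| <= `|h| -> is_derive s 1 f (df s)) ->
  exists2 s, `|s| <= `|h| & f h - f 0 = df s * h.
Proof.
move=> dfP.
have cont (i : interval R) : (forall s, s \in i -> `|s| <= `|h|) ->
    {within [set` i], continuous f}.
  move=> ih; apply: derivable_within_continuous => s /ih /dfP [].
  by [].
have [h0|h0] := leP 0 h.
  have I s : s \in `[0, h]%R -> `|s| <= `|h|.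
    by rewrite in_itv /= => /andP[s0 sh]; rewrite !ger0_norm.
  have [||s sI E] := MVT_segment h0 (df := df) (f := f).
  - by move=> s sI; apply/dfP/I; exact: subset_itv_oo_cc.
  - exact: cont.
  by exists s; [exact: I|rewrite E subr0].
have I s : s \in `[h, 0]%R -> `|s| <= `|h|.
  rewrite in_itv /= => /andP[s0 sh]; rewrite !ler0_norm ?lerN2 //.
  exact: ltW.
have [||s sI E] := MVT_segment (ltW h0) (df := df) (f := f).
- by move=> s sI; apply/dfP/I; exact: subset_itv_oo_cc.
- exact: cont.
exists s; first exact: I.
by rewrite -opprB E sub0r mulrN opprK.
Qed.

Lemma norm_coord_le (x : 'rV[R]_n) j : `|x 0 j| <= `|x|.
Proof.
rewrite [leRHS]/Num.Def.normr /= mx_normrE.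
exact: (le_bigmax _ (fun ij : 'I_1 * 'I_n => `|x ij.1 ij.2|) (0, j)).
Qed.

Lemma norm_le_coord (x : 'rV[R]_n) c : 0 <= c ->
  (forall j, `|x 0 j| <= c) -> `|x| <= c.
Proof.
move=> c0 xc; rewrite [leLHS]/Num.Def.normr /= mx_normrE.
by apply: bigmax_le => // -[i j] _ /=; rewrite ord1.
Qed.

(** The vertices of an axis-parallel path from $0$ to [h]; consecutive ones differ by one coordinate
    of [h]. *)
Definition row_take k (h : 'rV[R]_n) : 'rV[R]_n :=
  \row_j (if (j < k)%N then h 0 j else 0).

Lemma row_takeS (k : 'I_n) h : row_take k.+1 h = h 0 k *: e_ k + row_take k h.
Proof.
apply/rowP => j; rewrite !mxE eqxx /= ltnS leq_eqVlt.
have [jk|jk] := eqVneq (j : nat) k.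
  have -> : j = k by exact: val_inj.
  by rewrite eqxx /= ltnn mulr1 addr0.
rewrite /=; have -> : (j == k) = false by apply/negbTE; apply: contraNneq jk => ->.
by rewrite mulr0 add0r.
Qed.

(* Write [g (h + p) - g p] as a telescoping sum of increments along the
   coordinate axes and apply the mean value theorem to each of them. *)
Lemma continuous_partials_differentiable g p :
  (\forall y \near p, forall j, derivable g y (e_ j)) ->
  (forall j, {for p, continuous (fun y => 'D_(e_ j) g y)}) ->
  differentiable g p.
Proof.
move=> dg cg.
pose d (h : 'rV[R]_n) := \sum_j h 0 j * 'D_(e_ j) g p.
have lin_d : linear d.
  move=> a x y; rewrite /d scaler_sumr -big_split; apply: eq_bigr => j _ /=.
  by rewrite !mxE mulrDl -mulrA.
pose dM := GRing.isLinear.Build _ _ _ _ _ lin_d.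
pose dL : {linear _ -> _} := HB.pack d dM.
have cd : continuous d.
  move=> x; apply: differentiable_continuous.
  have -> : d = \sum_j (fun h : 'rV[R]_n => h 0 j * 'D_(e_ j) g p).
    by apply/funext => h; rewrite fct_sumE.
  apply: differentiable_sum => j; apply: differentiableM => //.
  exact: differentiable_coord.
have E : g \o shift p = cst (g p) + d +o_ 0 id.
  apply/eqaddoP => _/posnumP[eps].
  (* Each of the [n] increments gets this share of the error. Dividing by $n+1$ instead of $n$ also
     covers dimension zero. *)
  have e0 : 0 < eps%:num / n.+1%:R :> R by rewrite divr_gt0.
  have near_j j : \forall y \near p, derivable g y (e_ j) /\
      `|'D_(e_ j) g p - 'D_(e_ j) g y| <= eps%:num / n.+1%:R.
    apply: filterI; first by apply: filterS dg => y /(_ j).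
    by have /cvgrPdist_le /(_ _ e0) := cg j.
  have := filter_forall (nbhs_filter p) near_j.
  move=> /nbhs_ballP[r /= r0 rP].
  have near0 : \forall h \near (0 : 'rV[R]_n), `|h| < r.
    exact: pseudometric_normed_Zmodule.nbhs0_lt.
  near=> h.
  have hr : `|h| < r.
    by near: h; exact: near0.
  change (`|g (h + p) - (g p + d h)| <= eps%:num * `|h|).
  have -> : g (h + p) - (g p + d h) = \sum_(k < n)
      (g (row_take k.+1 h + p) - g (row_take k h + p) - h 0 k * 'D_(e_ k) g p).
    rewrite sumrB -/(d h) opprD addrA; congr (_ - _).
    rewrite -(big_mkord xpredT
      (fun k => g (row_take k.+1 h + p) - g (row_take k h + p))).
    rewrite telescope_sumr //; congr (g (_ + p) - g _).
      by apply/rowP => j; rewrite mxE ltn_ord.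
    by rewrite -[LHS]add0r; congr (_ + _); apply/rowP => j; rewrite !mxE.
  apply: le_trans (_ : \sum_(k < n) (eps%:num / n.+1%:R * `|h|) <= _).
    apply: le_trans (ler_norm_sum _ _ _) _; apply: ler_sum => k _.
    pose q := row_take k h + p.
    (* The norm is the maximum norm, so a point whose displacement from [p] is coordinatewise at
       most [h] in absolute value lies within $|h|<r$ of [p]. *)
    have qP s : `|s| <= `|h 0 k| -> ball p r (s *: e_ k + q).
      move=> sh; rewrite -ball_normE /ball_ /= /q addrA opprD.
      rewrite [- (_ + _) - p]addrC addrA subrr add0r normrN.
      apply: le_lt_trans hr; apply: norm_le_coord => // j; rewrite !mxE eqxx /=.
      have [->|jk] := eqVneq j k.
        by rewrite ltnn mulr1 addr0 (le_trans sh) // norm_coord_le.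
      rewrite mulr0 add0r; case: ifP => _; first exact: norm_coord_le.
      by rewrite normr0.
    have [s sh sE] := @mean_value0 (fun s => g (s *: e_ k + q))
      (fun s => 'D_(e_ k) g (s *: e_ k + q)) (h 0 k)
      (fun s sh => line_is_derive (rP _ (qP s sh) k).1).
    rewrite row_takeS -[_ + _ + p]addrA -/q.
    move: sE; rewrite /= scale0r add0r => ->.
    rewrite [X in `|_ - X|]mulrC -mulrBl normrM distrC.
    apply: ler_pM => //; last exact: norm_coord_le.
    exact: (rP _ (qP s sh) k).2.
  rewrite sumr_const card_ord -[leLHS]mulr_natl mulrA ler_wpM2r //.
  rewrite mulrCA ler_piMr // ler_pdivrMr ?ltr0n // mul1r ler_nat //.
apply/diff_locallyP; have dE : 'd g p = d :> (_ -> _).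
  exact: (@diff_unique _ _ _ _ dL).
by rewrite dE.
Unshelve. all: by end_near. Qed.

Lemma smooth_on_differentiable U f x : open U -> smooth_on U f -> U x ->
  differentiable f x.
Proof.
move=> oU sf Ux; apply: continuous_partials_differentiable.
  apply: filterS (open_nbhs_nbhs (conj oU Ux)) => y Uy j.
  exact: smooth_on_derivable Uy.
move=> j; exact: smooth_on_continuous (smooth_on_derive j sf) Ux.
Qed.

(** Restricting [phi] to the line through [x] in direction [v] gives a curve, for which derivability
    and differentiability agree. Hence [phi] need only be derivable in that one direction. *)
Lemma is_derive_comp_rV (V : normedModType R) (phi : V -> 'rV[R]_n) g x v :
  (forall a, derivable (fun y => phi y 0 a) x v) ->
  differentiable g (phi x) ->
  is_derive x v (g \o phi)
    (\sum_a 'D_v (fun y => phi y 0 a) x * 'D_(e_ a) g (phi x)).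
Proof.
move=> dphi dg.
have dphi' : derivable phi x v.
  by apply/derivable_mxP => i j; rewrite ord1.
pose c (h : R) := phi (h *: v + x).
have c0 : c 0 = phi x by rewrite /c scale0r add0r.
have dc : differentiable c 0.
  by apply/derivable1_diffP; apply: (derivable1P _ _ _).1.
have dgc : differentiable (g \o c) 0.
  by apply: differentiable_comp => //; rewrite c0.
have dgphi : derivable (g \o phi) x v.
  exact: (derivable1P (g \o phi) x v).2 ((derivable1_diffP (g \o c) 0).2 dgc).
apply: DeriveDef => //.
have L (W : normedModType R) (F : V -> W) :
    'D_1 (fun h : R => F (h *: v + x)) 0 = 'D_v F x.
  rewrite /derive; set g1 := fun h => h^-1 *: _; set g2 := fun h => h^-1 *: _.
  suff -> : g1 = g2 by [].
  by rewrite funeqE /g1 /g2 => h /=; rewrite addr0 scale0r add0r [_%:A]mulr1.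
have dcE : 'd c 0 1 = 'D_v phi x by rewrite -deriveE // -(L _ phi).
rewrite -L -[LHS]/('D_1 (g \o c) 0) deriveE // diff_comp //; last by rewrite c0.
rewrite /= dcE derive_mx // c0 (row_sum_delta (\matrix_(_, _) _)) linear_sum.
by apply: eq_bigr => a _; rewrite linearZ /= -deriveE // mxE.
Qed.

End smooth_on_theory.

(** * Covariant derivatives over a ring with derivations *)

Section connection_algebra.
Variables (A : comPzRingType) (n : nat).
Variable pd : 'I_n -> {additive A -> A}.
Hypothesis pdM : forall a f g, pd a (f * g) = pd a f * g + f * pd a g.
Variable G : 'I_n -> 'I_n -> 'I_n -> A.
Hypothesis Gsym : forall a b c, G a b c = G b a c.
Implicit Types (a b c d e f : 'I_n) (X : 'I_n -> A) (P S E : 'I_n -> 'I_n -> A)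
  (T : 'I_n -> 'I_n -> 'I_n -> 'I_n -> A).

(** This is $K_{ab}{}^c{}_d$ in a coordinate frame. The contraction in [ric] follows the convention
    $(\nabla_b\nabla_a-\nabla_a\nabla_b)X^b=R_{ab}X^b$. *)
Definition curv a b c d : A :=
  pd a (G b d c) - pd b (G a d c)
  + \sum_e G a e c * G b d e - \sum_e G b e c * G a d e.

Definition ric a b : A := \sum_c curv c a c b.

Definition cov10 X a c : A := pd a (X c) + \sum_d G a d c * X d.

Definition cov20 S a b c : A :=
  pd a (S b c) + \sum_d G a d b * S d c + \sum_d G a d c * S b d.

Definition cov02 P a b c : A :=
  pd a (P b c) - \sum_d G a b d * P d c - \sum_d G a c d * P b d.

(* The lower index of an endomorphism field comes first. *)
Definition cov11 E a b c : A :=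
  pd a (E b c) + \sum_d G a d c * E b d - \sum_d G a b d * E d c.

(* [T a b c d] stands for $T_{ab}{}^c{}_d$. *)
Definition cov13 T e a b c d : A :=
  pd e (T a b c d) + \sum_f G e f c * T a b f d - \sum_f G e a f * T f b c d
  - \sum_f G e b f * T a f c d - \sum_f G e d f * T a b c f.

Lemma sum_delta (F : 'I_n -> A) a : \sum_b (a == b)%:R * F b = F a.
Proof.
rewrite (bigD1 a) //= eqxx mul1r big1 ?addr0 // => b /negPf.
by rewrite eq_sym => ->; rewrite mul0r.
Qed.

Lemma sum_delta' (F : 'I_n -> A) a : \sum_b F b * (a == b)%:R = F a.
Proof. by rewrite -[RHS]sum_delta; apply: eq_bigr => b _; rewrite mulrC. Qed.

Lemma sum_swap (g : 'I_n -> 'I_n -> A) X Y :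
  \sum_e (\sum_f g e f * X f) * Y e = \sum_e X e * \sum_f g f e * Y f.
Proof.
under eq_bigr do rewrite mulr_suml; rewrite exchange_big /=.
apply: eq_bigr => e _; rewrite mulr_sumr; apply: eq_bigr => f _; ring.
Qed.

Lemma pd1 a : pd a 1 = 0.
Proof.
have := pdM a 1 1; rewrite !mulr1 mul1r => H.
by apply: (addrI (pd a 1)); rewrite addr0 -H.
Qed.

Lemma pd_nat a k : pd a k%:R = 0.
Proof. by rewrite raddfMn /= pd1 mul0rn. Qed.

Lemma pd_natl a k (f : A) : pd a (k%:R * f) = k%:R * pd a f.
Proof. by rewrite pdM pd_nat mul0r add0r. Qed.

Definition dmx p q a (F : 'M[A]_(p, q)) := map_mx (pd a) F.

Lemma dmxD p q a (F H : 'M[A]_(p, q)) : dmx a (F + H) = dmx a F + dmx a H.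
Proof. exact: map_mxD. Qed.

Lemma dmxN p q a (F : 'M[A]_(p, q)) : dmx a (- F) = - dmx a F.
Proof. exact: map_mxN. Qed.

Lemma dmxM p q r a (F : 'M[A]_(p, q)) (H : 'M[A]_(q, r)) :
  dmx a (F *m H) = dmx a F *m H + F *m dmx a H.
Proof.
apply/matrixP => i j; rewrite !mxE raddf_sum -big_split /=.
by apply: eq_bigr => k _; rewrite pdM !mxE.
Qed.

(** With the direction [a] as a parameter, the connection becomes a family of operators
    $\partial_a+\Gamma_a$ on column vectors, and curvature identities become expansions of matrix
    products. *)
Definition Gmx a : 'M[A]_n := \matrix_(c, d) G a d c.

Definition curvmx a b : 'M[A]_n :=
  dmx a (Gmx b) - dmx b (Gmx a) + Gmx a *m Gmx b - Gmx b *m Gmx a.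

Lemma curvmxE a b c d : curvmx a b c d = curv a b c d.
Proof.
rewrite /curvmx /curv !mxE.
by congr (_ - _ + _ - _); apply: eq_bigr => e _; rewrite !mxE.
Qed.

Lemma entryD p q (F H : 'M[A]_(p, q)) i j : (F + H) i j = F i j + H i j.
Proof. by rewrite mxE. Qed.

Lemma entryN p q (F : 'M[A]_(p, q)) i j : (- F) i j = - F i j.
Proof. by rewrite mxE. Qed.

(** Expand the commutator of $\partial_a+\Gamma_a$ and $\partial_b+\Gamma_b$. The commutator of the
    derivations is kept, since its vanishing on a chart is later deduced from this identity. *)
Lemma ricci_identity_mx p (X : 'M[A]_(n, p)) a b :
  let Y c := dmx c X + Gmx c *m X in
  (dmx a (Y b) + Gmx a *m Y b) - (dmx b (Y a) + Gmx b *m Y a)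
  = dmx a (dmx b X) - dmx b (dmx a X) + curvmx a b *m X.
Proof.
rewrite /curvmx /= !dmxD !dmxM !(mulmxDl, mulmxDr, mulNmx, mulmxA).
by apply/matrixP => i j; rewrite !(entryD, entryN); ring.
Qed.

(** Compared with the matrix version, the lower index contributes $-\Gamma_{ab}{}^d\nabla_dX^c$,
    which is symmetric in $a,b$ by [Gsym] and cancels. *)
Lemma ricci_identity X a b c :
  cov11 (cov10 X) a b c - cov11 (cov10 X) b a c
  = pd a (pd b (X c)) - pd b (pd a (X c)) + \sum_d curv a b c d * X d.
Proof.
pose x : 'M[A]_(n, 1) := \matrix_(i, j) X i.
have := congr1 (fun m : 'M[A]_(n, 1) => m c 0) (ricci_identity_mx x a b).
have E e f : (dmx e x + Gmx e *m x) f 0 = cov10 X e f.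
  by rewrite !mxE; congr (_ + _); apply: eq_bigr => g _; rewrite !mxE.
rewrite /= !(entryD, entryN) => H.
have {H} : pd a (cov10 X b c) + \sum_d G a d c * cov10 X b d
   - (pd b (cov10 X a c) + \sum_d G b d c * cov10 X a d)
  = pd a (pd b (X c)) - pd b (pd a (X c)) + \sum_d curv a b c d * X d.
  rewrite -!E.
  apply: etrans (etrans H _); last first.
    by rewrite !mxE; congr (_ - _ + _); apply: eq_bigr => d _;
      rewrite curvmxE !mxE.
  congr (_ + _ - (_ + _)); rewrite ?mxE //;
    by apply: eq_bigr => d _; rewrite E !mxE.
have Gs : \sum_d G a b d * cov10 X d c = \sum_d G b a d * cov10 X d c.
  by apply: eq_bigr => d _; rewrite Gsym.
by rewrite /cov11 Gs => <-; ring.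
Qed.

Lemma curvN a b c d : curv b a c d = - curv a b c d.
Proof. by rewrite /curv; ring. Qed.

Lemma cov13N e a b c d : cov13 curv e b a c d = - cov13 curv e a b c d.
Proof.
have N g (h k : 'I_n -> A) : (forall f, h f = - k f) ->
    \sum_f g f * h f = - \sum_f g f * k f.
  by move=> hk; rewrite -sumrN; apply: eq_bigr => f _; rewrite hk mulrN.
rewrite /cov13 curvN raddfN /= (N _ _ (fun f => curv a b f d)) //;
  last by move=> f; exact: curvN.
rewrite (N (G e a) _ (fun f => curv f b c d)); last by move=> f; exact: curvN.
rewrite (N (G e b) _ (fun f => curv a f c d)); last by move=> f; exact: curvN.
rewrite (N (G e d) _ (fun f => curv a b c f)); last by move=> f; exact: curvN.
ring.
Qed.

(** By [Gsym], both the derivative terms and the quadratic terms cancel in pairs in the cyclic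
    sum. *)
Lemma bianchi1 a b d c : curv a b c d + curv b d c a + curv d a c b = 0.
Proof.
have E x y z : \sum_e G x e c * G y z e = \sum_e G x e c * G z y e.
  by apply: eq_bigr => e _; rewrite (Gsym y).
rewrite /curv (E a b d) (E b a d) (E d b a) (Gsym b d) (Gsym a d) (Gsym b a).
ring.
Qed.

(** Contraction commutes with covariant differentiation: the Christoffel terms of the two contracted
    indices cancel. *)
Lemma cov13_contr T e a d :
  \sum_c cov13 T e c a c d = cov02 (fun b f => \sum_c T c b c f) e a d.
Proof.
rewrite /cov13 /cov02 !sumrB big_split /= (raddf_sum (pd e)).
have -> : \sum_c \sum_f G e f c * T c a f d = \sum_c \sum_f G e c f * T f a c d.
  by rewrite exchange_big.
rewrite addrK; congr (_ - _ - _); rewrite exchange_big /=;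
  by apply: eq_bigr => f _; rewrite mulr_sumr.
Qed.

Lemma cov11_trace E a : \sum_b cov11 E a b b = pd a (\sum_b E b b).
Proof.
rewrite /cov11 sumrB big_split /= (raddf_sum (pd a)).
by rewrite [X in _ - X]exchange_big /= addrK.
Qed.

(** The Leibniz rule for a contracted product. The Christoffel terms at the contracted index [e],
    one from each factor, cancel by [sum_swap]. *)
Lemma cov11_contr02 P S a b c :
  cov11 (fun b c => \sum_e P b e * S c e) a b c
  = \sum_e (cov02 P a b e * S c e + P b e * cov20 S a c e).
Proof.
rewrite /cov11 (raddf_sum (pd a)) /=.
have -> : \sum_d G a d c * (\sum_e P b e * S d e)
          = \sum_e P b e * (\sum_d G a d c * S d e).
  under eq_bigr do rewrite mulr_sumr; rewrite exchange_big /=.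
  by apply: eq_bigr => e _; rewrite mulr_sumr; apply: eq_bigr => d _; ring.
have -> : \sum_d G a b d * (\sum_e P d e * S c e)
          = \sum_e (\sum_d G a b d * P d e) * S c e.
  under eq_bigr do rewrite mulr_sumr; rewrite exchange_big /=.
  by apply: eq_bigr => e _; rewrite mulr_suml; apply: eq_bigr => d _; ring.
have H := sum_swap (G a) (P b) (S c).
rewrite -big_split -sumrB /=.
apply/eqP; rewrite -subr_eq0 -sumrB; apply/eqP.
transitivity (\sum_e ((\sum_f G a e f * P b f) * S c e
    - P b e * (\sum_f G a f e * S c f))); last by rewrite sumrB H subrr.
by apply: eq_bigr => e _; rewrite pdM /cov02 /cov20; ring.
Qed.

Lemma pd_contr02 P S a :
  pd a (\sum_b \sum_c P b c * S b c)
  = \sum_b \sum_c (cov02 P a b c * S b c + P b c * cov20 S a b c).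
Proof.
rewrite -[LHS]/(pd a (\sum_b (fun b d => \sum_c P b c * S d c) b b)).
by rewrite -cov11_trace; apply: eq_bigr => b _; rewrite cov11_contr02.
Qed.

Lemma cov11_contr13 T S e a c :
  cov11 (fun a c => \sum_b \sum_d T a b c d * S b d) e a c
  = \sum_b \sum_d (cov13 T e a b c d * S b d + T a b c d * cov20 S e b d).
Proof.
have H := pd_contr02 (fun b d => T a b c d) S e.
rewrite /cov11 H.
have -> : \sum_f G e f c * (\sum_b \sum_d T a b f d * S b d)
  = \sum_b \sum_d (\sum_f G e f c * T a b f d) * S b d.
  under eq_bigr do (rewrite mulr_sumr; under eq_bigr do rewrite mulr_sumr).
  rewrite exchange_big /=; apply: eq_bigr => b _.
  rewrite exchange_big /=; apply: eq_bigr => d _.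
  by rewrite mulr_suml; apply: eq_bigr => f _; ring.
have -> : \sum_f G e a f * (\sum_b \sum_d T f b c d * S b d)
  = \sum_b \sum_d (\sum_f G e a f * T f b c d) * S b d.
  under eq_bigr do (rewrite mulr_sumr; under eq_bigr do rewrite mulr_sumr).
  rewrite exchange_big /=; apply: eq_bigr => b _.
  rewrite exchange_big /=; apply: eq_bigr => d _.
  by rewrite mulr_suml; apply: eq_bigr => f _; ring.
rewrite -big_split -sumrB; apply: eq_bigr => b _ /=.
rewrite -big_split -sumrB; apply: eq_bigr => d _ /=.
by rewrite /cov02 /cov13; ring.
Qed.

(** The identity endomorphism is parallel, so only [h] is differentiated. *)
Lemma cov11_delta h a b c :
  cov11 (fun b c => (b == c)%:R * h) a b c = (b == c)%:R * pd a h.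
Proof.
rewrite /cov11 pd_natl.
have -> : \sum_d G a d c * ((b == d)%:R * h) = G a b c * h.
  rewrite -(sum_delta (fun d => G a d c * h)).
  by apply: eq_bigr => d _; ring.
have -> : \sum_d G a b d * ((d == c)%:R * h) = G a b c * h.
  rewrite -(sum_delta (fun d => G a b d * h)).
  by apply: eq_bigr => d _; rewrite eq_sym; ring.
by rewrite addrK.
Qed.

Lemma cov11D E E' a b c :
  cov11 (fun b c => E b c + E' b c) a b c = cov11 E a b c + cov11 E' a b c.
Proof.
rewrite /cov11 raddfD /=.
under eq_bigr do rewrite mulrDr; rewrite big_split /=.
under [X in _ - X]eq_bigr do rewrite mulrDr; rewrite big_split /=; ring.
Qed.

Lemma cov11N E a b c : cov11 (fun b c => - E b c) a b c = - cov11 E a b c.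
Proof.
rewrite /cov11 raddfN /=.
under eq_bigr do rewrite mulrN; rewrite sumrN.
under [X in _ - X]eq_bigr do rewrite mulrN; rewrite sumrN; ring.
Qed.

Lemma cov11_natl k E a b c :
  cov11 (fun b c => k%:R * E b c) a b c = k%:R * cov11 E a b c.
Proof.
rewrite /cov11 pd_natl mulrBr mulrDr !mulr_sumr.
by congr (_ + _ - _); apply: eq_bigr => d _; ring.
Qed.

Lemma cov02_natl k P a b c :
  cov02 (fun b c => k%:R * P b c) a b c = k%:R * cov02 P a b c.
Proof.
rewrite /cov02 pd_natl !mulrBr !mulr_sumr.
by congr (_ - _ - _); apply: eq_bigr => d _; ring.
Qed.

Lemma eq_cov11 E E' a b c : (forall b c, E b c = E' b c) ->
  cov11 E a b c = cov11 E' a b c.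
Proof.
by move=> EE; rewrite /cov11 EE; congr (_ + _ - _);
  apply: eq_bigr => d _; rewrite EE.
Qed.

Lemma eq_cov02 P P' a b c : (forall b c, P b c = P' b c) ->
  cov02 P a b c = cov02 P' a b c.
Proof.
by move=> EE; rewrite /cov02 EE; congr (_ - _ - _);
  apply: eq_bigr => d _; rewrite EE.
Qed.

(** * Second Bianchi identity and trace of the curvature, for commuting derivations *)

Section flat_partials.
Hypothesis pdC : forall a b (f : A), pd a (pd b f) = pd b (pd a f).

Lemma dmxC p q a b (F : 'M[A]_(p, q)) : dmx a (dmx b F) = dmx b (dmx a F).
Proof. by apply/matrixP => i j; rewrite !mxE pdC. Qed.

(** [L] is the derivative of endomorphisms with the two form indices left alone. The identity is the
    Jacobi identity for the operators $\partial_a+\Gamma_a$. *)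
Lemma bianchi2_mx a b c :
  let L e (F : 'M[A]_n) := dmx e F + Gmx e *m F - F *m Gmx e in
  L c (curvmx a b) + L a (curvmx b c) + L b (curvmx c a) = 0.
Proof.
rewrite /= /curvmx !(dmxD, dmxN, dmxM).
rewrite (dmxC a b) (dmxC a c) (dmxC b c).
rewrite !(mulmxDl, mulmxDr, mulNmx, mulmxN, mulmxA).
by apply/matrixP => i j; rewrite !(entryD, entryN) [RHS]mxE; ring.
Qed.

Lemma bianchi2 a b c d e :
  cov13 curv c a b d e + cov13 curv a b c d e + cov13 curv b c a d e = 0.
Proof.
have := congr1 (fun m : 'M[A]_n => m d e) (bianchi2_mx a b c).
rewrite /= [RHS]mxE !(entryD, entryN) => H.
(* The full covariant derivative differs from the matrix one by Christoffel terms at the two form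
   indices. Over the cyclic sum these cancel in pairs, by [C]. *)
have E x y z : dmx z (curvmx x y) d e + (Gmx z *m curvmx x y) d e
   - (curvmx x y *m Gmx z) d e = cov13 curv z x y d e
   + \sum_f G z x f * curv f y d e + \sum_f G z y f * curv x f d e.
  rewrite /cov13.
  have -> : dmx z (curvmx x y) d e = pd z (curv x y d e).
    by rewrite mxE curvmxE.
  have -> : (Gmx z *m curvmx x y) d e = \sum_f G z f d * curv x y f e.
    by rewrite mxE; apply: eq_bigr => f _; rewrite curvmxE mxE.
  have -> : (curvmx x y *m Gmx z) d e = \sum_f G z e f * curv x y d f.
    by rewrite mxE; apply: eq_bigr => f _; rewrite curvmxE mxE mulrC.
  ring.
have C x y z : \sum_f G z x f * curv f y d e
    = - \sum_f G x z f * curv y f d e.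
  by rewrite -sumrN; apply: eq_bigr => f _; rewrite Gsym curvN mulrN.
move: H; rewrite !E (C a b c) (C b c a) (C c a b) => <-; ring.
Qed.

(** Contract the upper index of the second Bianchi identity with the derivative index of its first
    term; the other two terms then become derivatives of [ric] by [cov13_contr]. *)
Lemma bianchi2_contr a b e :
  \sum_c cov13 curv c a b c e = cov02 ric a b e - cov02 ric b a e.
Proof.
have : \sum_c (cov13 curv c a b c e + cov13 curv a b c c e
               + cov13 curv b c a c e) = 0.
  by apply: big1 => c _; exact: bianchi2.
have -> : \sum_c (cov13 curv c a b c e + cov13 curv a b c c e
               + cov13 curv b c a c e) =
   \sum_c cov13 curv c a b c e + (- cov02 ric a b e + cov02 ric b a e).
  rewrite -!cov13_contr -sumrN -!big_split; apply: eq_bigr => c _ /=.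
  rewrite (cov13N a b c); ring.
by move=> /eqP; rewrite addr_eq0 => /eqP ->; ring.
Qed.

(* A parallel volume form has a component [eps] with
   [d_a eps = Gamma_ac^c eps], so the trace of the curvature annihilates it. *)
Lemma curv_trace_annihilates eps :
  (forall a, pd a eps = (\sum_c G a c c) * eps) ->
  forall a b, (\sum_c curv a b c c) * eps = 0.
Proof.
move=> epsE a b.
have := pdC a b eps; rewrite !epsE !pdM !epsE !raddf_sum /= => H.
rewrite /curv sumrB big_split sumrB /=.
rewrite [X in _ - X]exchange_big /=.
have -> : \sum_c \sum_e G a e c * G b c e = \sum_c \sum_e G b c e * G a e c.
  by apply: eq_bigr => c _; apply: eq_bigr => e _; rewrite mulrC.
rewrite addrK.
transitivity (((\sum_c pd a (G b c c)) * eps +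
      (\sum_c G b c c) * ((\sum_c G a c c) * eps)) -
 ((\sum_c pd b (G a c c)) * eps +
      (\sum_c G a c c) * ((\sum_c G b c c) * eps))).
  ring.
by rewrite H subrr.
Qed.

(** Contract the first Bianchi identity. *)
Lemma ric_skew a b : ric a b - ric b a = - \sum_c curv a b c c.
Proof.
rewrite /ric -sumrB -sumrN; apply: eq_bigr => c _.
have := bianchi1 a b c c; rewrite (curvN c b) => /eqP.
rewrite -addrA addr_eq0 => /eqP ->; ring.
Qed.

(** * Differential consequences of the metrizability equation *)

Section metrizability.
Variables (S : 'I_n -> 'I_n -> A) (X : 'I_n -> A).
Hypothesis SX : forall a b c,
  cov20 S a b c = (a == b)%:R * X c + (a == c)%:R * X b.

Hypothesis Ssym : forall b c, S b c = S c b.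

(** The commutator of covariant derivatives of [S] is computed twice: as the curvature acting on
    both upper indices, and by substituting [SX] for the first derivative. *)
Lemma metrizability_commutator a b c d :
  \sum_e curv a b c e * S e d + \sum_e curv a b d e * S c e
  = (b == c)%:R * cov10 X a d + (b == d)%:R * cov10 X a c
    - (a == c)%:R * cov10 X b d - (a == d)%:R * cov10 X b c.
Proof.
pose s : 'M[A]_n := \matrix_(i, j) S i j.
pose N a := dmx a s + Gmx a *m s + s *m (Gmx a)^T.
have dT x y : dmx x (Gmx y)^T = (dmx x (Gmx y))^T by rewrite /dmx map_trmx.
have H : (dmx a (N b) + Gmx a *m N b + N b *m (Gmx a)^T)
   - (dmx b (N a) + Gmx b *m N a + N a *m (Gmx b)^T)
   = curvmx a b *m s + s *m (curvmx a b)^T.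
  have cT : (curvmx a b)^T = (dmx a (Gmx b))^T - (dmx b (Gmx a))^T
      + (Gmx b)^T *m (Gmx a)^T - (Gmx a)^T *m (Gmx b)^T.
    apply/matrixP => i j; rewrite -!trmx_mul !(entryD, entryN) ![_^T _ _]mxE.
    by rewrite /curvmx !(entryD, entryN).
  rewrite cT /N /curvmx !(dmxD, dmxM) !dT (dmxC a b).
  rewrite !(mulmxDl, mulmxDr, mulNmx, mulmxN, mulmxA).
  by apply/matrixP => i j; rewrite !(entryD, entryN); ring.
have NE x y z : N x y z = (x == y)%:R * X z + (x == z)%:R * X y.
  rewrite -SX /N /cov20 !(entryD).
  congr (_ + _ + _); rewrite !mxE //; apply: eq_bigr => f _; rewrite !mxE //.
  by rewrite mulrC.
(* The last two terms appear because the lower index [y] is not differentiated covariantly here.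
   They are symmetric in [x] and [y], so they drop out of the commutator. *)
have FE x y : (dmx x (N y) + Gmx x *m N y + N y *m (Gmx x)^T) c d =
   (y == c)%:R * cov10 X x d + (y == d)%:R * cov10 X x c
   + (G x y c * X d + G x y d * X c).
  rewrite !entryD.
  have -> : dmx x (N y) c d = (y == c)%:R * pd x (X d) + (y == d)%:R * pd x (X c).
    by rewrite mxE NE raddfD /= !pd_natl.
  have -> : (Gmx x *m N y) c d = G x y c * X d
      + (y == d)%:R * \sum_e G x e c * X e.
    rewrite mxE -(sum_delta (fun e => G x e c * X d)) mulr_sumr -big_split.
    by apply: eq_bigr => e _; rewrite NE !mxE /=; ring.
  have -> : (N y *m (Gmx x)^T) c d = G x y d * X c
      + (y == c)%:R * \sum_e G x e d * X e.
    rewrite mxE -(sum_delta (fun e => G x e d * X c)) mulr_sumr -big_split.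
    by apply: eq_bigr => e _; rewrite NE !mxE /=; ring.
  rewrite /cov10; ring.
have := congr1 (fun m : 'M[A]_n => m c d) H.
rewrite /= [LHS]entryD [(- (_ : 'M[A]_n)) c d]entryN !FE (Gsym a b) (Gsym a b).
rewrite entryD => E.
transitivity ((curvmx a b *m s) c d + (s *m (curvmx a b)^T) c d).
  congr (_ + _); rewrite mxE; apply: eq_bigr => e _.
    by rewrite curvmxE [s _ _]mxE.
  by rewrite [_^T _ _]mxE curvmxE [s _ _]mxE mulrC.
by rewrite -E; ring.
Qed.

Lemma metrizability_contr a : \sum_b cov20 S b b a = n.+1%:R * X a.
Proof.
under eq_bigr do rewrite SX eqxx mul1r eq_sym.
by rewrite big_split /= sum_delta sumr_const card_ord -mulr_natl; ring.
Qed.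

Definition divergence : A := \sum_b cov10 X b b.

Lemma prolongation_mu a d :
  n%:R * cov10 X a d = (a == d)%:R * divergence - \sum_e ric a e * S d e
    + \sum_b \sum_e curv a b d e * S b e.
Proof.
have H : \sum_b (\sum_e curv a b b e * S e d + \sum_e curv a b d e * S b e)
  = \sum_b ((b == b)%:R * cov10 X a d + (b == d)%:R * cov10 X a b
    - (a == b)%:R * cov10 X b d - (a == d)%:R * cov10 X b b).
  by apply: eq_bigr => b _; rewrite metrizability_commutator.
rewrite big_split /= in H.
have E1 : \sum_b \sum_e curv a b b e * S e d = - \sum_e ric a e * S d e.
  rewrite exchange_big /= -sumrN; apply: eq_bigr => e _.
  rewrite /ric mulr_suml -sumrN; apply: eq_bigr => b _.
  by rewrite curvN mulNr Ssym.
(* The second and third terms contract to the same $\nabla_aX^d$ with opposite signs, which leaves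
   the coefficient $n$ from the first. *)
have E2 : \sum_b ((b == b)%:R * cov10 X a d + (b == d)%:R * cov10 X a b
    - (a == b)%:R * cov10 X b d - (a == d)%:R * cov10 X b b)
  = n%:R * cov10 X a d - (a == d)%:R * divergence.
  transitivity (\sum_b (cov10 X a d + (d == b)%:R * cov10 X a b
    - (a == b)%:R * cov10 X b d - (a == d)%:R * cov10 X b b)).
    by apply: eq_bigr => b _; rewrite eqxx mul1r (eq_sym b d).
  rewrite !sumrB big_split /= !sum_delta -mulr_sumr sumr_const card_ord.
  by rewrite -mulr_natl -/divergence; ring.
move: H; rewrite E1 E2 => /eqP; rewrite eq_sym subr_eq => /eqP ->; ring.
Qed.

Section einstein.
(** [k] is $n-1$. It is a natural number because the derivations kill naturals, while [A] is not
    assumed to contain their inverses. *)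
Variables (k : nat) (P : 'I_n -> 'I_n -> A).
Hypothesis nk : n = k.+1.
Hypothesis Psym : forall a b, P a b = P b a.
Hypothesis ricP : forall a b, ric a b = k%:R * P a b.
Hypothesis curv_trace : forall a b, \sum_c curv a b c c = 0.

(** Of the two [P] terms in the curvature, one is the trace that completes the divergence to
    $n\rho$; the other raises the coefficient of $P_{ae}\sigma^{de}$ from $n-1$ to $n$. *)
Lemma prolongation_mu_weyl W a d :
  (forall a b c d, curv a b c d
     = W a b c d + (a == c)%:R * P b d - (b == c)%:R * P a d) ->
  n%:R * cov10 X a d
  = (a == d)%:R * (divergence + \sum_b \sum_c P b c * S b c)
    - n%:R * (\sum_e P a e * S d e) + \sum_b \sum_e W a b d e * S b e.
Proof.
move=> curvW; rewrite prolongation_mu.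
have -> : \sum_e ric a e * S d e = k%:R * \sum_e P a e * S d e.
  by rewrite mulr_sumr; apply: eq_bigr => e _; rewrite ricP mulrA.
have -> : \sum_b \sum_e curv a b d e * S b e
    = \sum_b \sum_e W a b d e * S b e
      + (a == d)%:R * (\sum_b \sum_c P b c * S b c) - \sum_e P a e * S d e.
  rewrite -(sum_delta (fun b => \sum_e P a e * S b e)) mulr_sumr.
  rewrite -big_split -sumrB; apply: eq_bigr => b _ /=.
  rewrite !mulr_sumr -big_split -sumrB; apply: eq_bigr => e _ /=.
  by rewrite curvW (eq_sym d); ring.
have nA : n%:R = k%:R + 1 :> A by rewrite nk natr1.
by rewrite nA; ring.
Qed.

(** Take the divergence of [prolongation_mu] over its upper index. The common factor [k] remains, as
    it can be cancelled only after evaluation in the real numbers. *)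
Lemma prolongation_rho a :
  k%:R * pd a (divergence + \sum_b \sum_c P b c * S b c)
  = k%:R * (2 * (\sum_b \sum_c (cov02 P a b c - cov02 P b a c) * S b c)
            - 2 * n%:R * \sum_b P a b * X b).
Proof.
set Q := \sum_b \sum_c cov02 P a b c * S b c.
set Z := \sum_b \sum_c cov02 P b a c * S b c.
set p := \sum_b P a b * X b.
have -> : \sum_b \sum_c (cov02 P a b c - cov02 P b a c) * S b c = Q - Z.
  rewrite -sumrB; apply: eq_bigr => b _; rewrite -sumrB.
  by apply: eq_bigr => c _; rewrite mulrBl.
have ricX : \sum_d ric a d * X d = k%:R * p.
  by rewrite mulr_sumr; apply: eq_bigr => d _; rewrite ricP mulrA.
have ric02 e b c : cov02 ric e b c = k%:R * cov02 P e b c.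
  by rewrite -cov02_natl; apply: eq_cov02.
(* Commuting the derivatives in $\nabla_b\nabla_aX^b$ produces the Ricci term. *)
have D1 : \sum_b cov11 (cov10 X) b a b = pd a divergence + k%:R * p.
  rewrite -cov11_trace -ricX; apply/eqP; rewrite addrC -subr_eq -sumrB.
  apply/eqP.
  transitivity (\sum_b \sum_d curv b a b d * X d).
    by apply: eq_bigr => b _; rewrite ricci_identity pdC subrr add0r.
  by rewrite exchange_big; apply: eq_bigr => d _; rewrite -mulr_suml.
have E1 : \sum_b cov11 (fun b c => (b == c)%:R * divergence) b a b
    = pd a divergence.
  rewrite -[RHS](sum_delta (fun b => pd b divergence)).
  by apply: eq_bigr => b _; rewrite cov11_delta.
have E2 : \sum_b cov11 (fun a d => \sum_e ric a e * S d e) b a b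
    = k%:R * Z + n.+1%:R * (k%:R * p).
  have -> : \sum_b cov11 (fun a d => \sum_e ric a e * S d e) b a b
      = \sum_b \sum_e cov02 ric b a e * S b e
        + \sum_e ric a e * \sum_b cov20 S b b e.
    under [X in _ = _ + X]eq_bigr do rewrite mulr_sumr.
    rewrite [X in _ = _ + X]exchange_big -big_split; apply: eq_bigr => b _.
    by rewrite cov11_contr02 big_split.
  congr (_ + _).
    rewrite mulr_sumr; apply: eq_bigr => b _; rewrite mulr_sumr.
    by apply: eq_bigr => c _; rewrite ric02 mulrA.
  rewrite -ricX mulr_sumr; apply: eq_bigr => e _.
  by rewrite metrizability_contr mulrCA.
(* The derivative of the curvature is given by the contracted Bianchi identity. The derivative of
   [S] gives a Ricci term and a trace of the curvature, which vanishes by [curv_trace]. *)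
have E3 : \sum_b cov11 (fun a d => \sum_c \sum_e curv a c d e * S c e) b a b
    = k%:R * (Q - Z) - k%:R * p.
  have -> : \sum_b cov11 (fun a d => \sum_c \sum_e curv a c d e * S c e) b a b
      = \sum_c \sum_e (\sum_b cov13 curv b a c b e) * S c e
        + \sum_b \sum_c \sum_e curv a c b e * cov20 S b c e.
    have -> : \sum_c \sum_e (\sum_b cov13 curv b a c b e) * S c e
      = \sum_b \sum_c \sum_e cov13 curv b a c b e * S c e.
      rewrite [RHS]exchange_big; apply: eq_bigr => c _.
      rewrite [RHS]exchange_big; apply: eq_bigr => e _.
      by rewrite mulr_suml.
    rewrite -big_split; apply: eq_bigr => b _.
    rewrite cov11_contr13 -big_split; apply: eq_bigr => c _.
    by rewrite -big_split.
  congr (_ + _).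
    rewrite -sumrB mulr_sumr; apply: eq_bigr => c _.
    rewrite -sumrB mulr_sumr; apply: eq_bigr => e _.
    by rewrite bianchi2_contr !ric02; ring.
  transitivity (\sum_b ((\sum_e curv a b b e * X e)
                        + \sum_c curv a c b b * X c)).
    apply: eq_bigr => b _.
    rewrite -(sum_delta (fun c => \sum_e curv a c b e * X e)) -big_split.
    apply: eq_bigr => c _.
    rewrite mulr_sumr -(sum_delta (fun e => curv a c b e * X c)) -big_split.
    by apply: eq_bigr => e _; rewrite SX /=; ring.
  rewrite big_split /= [X in _ + X]exchange_big /= [X in _ + X]big1 ?addr0.
    rewrite -ricX -sumrN exchange_big; apply: eq_bigr => e _.
    rewrite /ric mulr_suml -sumrN; apply: eq_bigr => b _.
    by rewrite curvN mulNr.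
  by move=> c _; rewrite -mulr_suml curv_trace mul0r.
have D2 : n%:R * (pd a divergence + k%:R * p) = pd a divergence
    - (k%:R * Z + n.+1%:R * (k%:R * p)) + (k%:R * (Q - Z) - k%:R * p).
  rewrite -D1 -E1 -E2 -E3 mulr_sumr -sumrB -big_split; apply: eq_bigr => b _.
  rewrite -cov11_natl (eq_cov11 _ _ _ prolongation_mu).
  rewrite (cov11D (fun a d => (a == d)%:R * divergence - \sum_e ric a e * S d e)
     (fun a d => \sum_b0 \sum_e curv a b0 d e * S b0 e)).
  rewrite (cov11D (fun a d => (a == d)%:R * divergence)
     (fun a d => - \sum_e ric a e * S d e)).
  by rewrite (cov11N (fun a d => \sum_e ric a e * S d e)).
have D3 : pd a (\sum_b \sum_c P b c * S b c) = Q + 2 * p.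
  rewrite pd_contr02.
  have -> : 2 * p = \sum_b P b a * X b + \sum_c P a c * X c.
    rewrite (eq_bigr (fun b => P a b * X b)) => [|b _]; last by rewrite Psym.
    by rewrite -/p; ring.
  have -> : \sum_c P a c * X c = \sum_b \sum_c P b c * ((a == b)%:R * X c).
    rewrite -(sum_delta (fun b => \sum_c P b c * X c)).
    apply: eq_bigr => b _; rewrite mulr_sumr; apply: eq_bigr => c _; ring.
  rewrite -!big_split; apply: eq_bigr => b _ /=.
  rewrite -(sum_delta (fun c => P b c * X b)) -!big_split.
  by apply: eq_bigr => c _ /=; rewrite SX; ring.
(* With $n=k+1$, [D2] amounts to $k\,\partial_a\mathrm{div}=k(Q-2Z-(2n+2)p)$, and [D3] adds
   $k(Q+2p)$. *)
rewrite raddfD /= D3.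
have nA : n%:R = k%:R + 1 :> A by rewrite nk natr1.
move: D2; rewrite -natr1 nA => /eqP; rewrite -subr_eq0 => /eqP D2.
by apply/eqP; rewrite -subr_eq0 -[X in _ == X]D2; apply/eqP; ring.
Qed.

End einstein.
End metrizability.
End flat_partials.
End connection_algebra.

(** * Invariance of the divergence and of the full contraction, pointwise *)

Section change_of_frame.
Variables (A : comPzRingType) (n : nat).
(* [J b e] is the Jacobian entry $\partial y^b/\partial x^e$ and [K] is its
   inverse; [H f a c] and [L b a e] are the derivatives along $y^a$ of [K f c]
   and [J b e]. *)
Variables (J K : 'I_n -> 'I_n -> A) (H L : 'I_n -> 'I_n -> 'I_n -> A).
Hypothesis JK : forall a b, \sum_e J a e * K e b = (a == b)%:R.
Hypothesis KJ : forall a b, \sum_e K a e * J e b = (a == b)%:R.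
Hypothesis HL : forall a f e, \sum_c (H f a c * J c e + K f c * L c a e) = 0.

(** The inhomogeneous term of the Christoffel symbols cancels the derivative of the Jacobian, by
    [HL]. The derivatives [dX] and [dX'] are plain data, so the statement is pure algebra at one
    point. *)
Lemma divergence_change (G G' : 'I_n -> 'I_n -> 'I_n -> A) (X X' : 'I_n -> A)
    (dX dX' : 'I_n -> 'I_n -> A) :
  (forall a b c, G' a b c = \sum_f J c f *
     (\sum_d \sum_e K d a * K e b * G d e f + H f a b)) ->
  (forall b, X' b = \sum_e J b e * X e) ->
  (forall a b, dX' a b
     = \sum_e (L b a e * X e + J b e * \sum_d K d a * dX d e)) ->
  \sum_a (dX' a a + \sum_b G' a b a * X' b)
  = \sum_a (dX a a + \sum_b G a b a * X b).
Proof.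
move=> G'E X'E dX'E.
pose xi d c := dX d c + \sum_b G d b c * X b.
have KX e : \sum_b K e b * X' b = X e.
  transitivity (\sum_g (e == g)%:R * X g); last exact: sum_delta.
  under eq_bigr do rewrite X'E mulr_sumr.
  rewrite exchange_big /=; apply: eq_bigr => g _.
  by rewrite -KJ mulr_suml; apply: eq_bigr => b _; ring.
have HX f a : \sum_b H f a b * X' b = - \sum_c K f c * \sum_e L c a e * X e.
  apply/eqP; rewrite -addr_eq0; apply/eqP.
  transitivity (\sum_e (\sum_c (H f a c * J c e + K f c * L c a e)) * X e).
    under [RHS]eq_bigr do rewrite mulr_suml.
    rewrite [RHS]exchange_big -big_split; apply: eq_bigr => c _ /=.
    rewrite X'E !mulr_sumr -big_split; apply: eq_bigr => e _ /=; ring.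
  by rewrite big1 // => e _; rewrite HL mul0r.
(* The subtracted sum is exactly the non-tensorial part of [dX'], so the two cancel when the
   divergence is formed. *)
have GX a c : \sum_b G' a b c * X' b
   = \sum_f J c f * (\sum_d K d a * \sum_e G d e f * X e)
     - \sum_e L c a e * X e.
  have -> : \sum_e L c a e * X e
      = \sum_f J c f * \sum_c' K f c' * \sum_e L c' a e * X e.
    transitivity (\sum_c' (c == c')%:R * \sum_e L c' a e * X e).
      by rewrite sum_delta.
    under [RHS]eq_bigr do rewrite mulr_sumr.
    rewrite [RHS]exchange_big /=; apply: eq_bigr => c' _.
    by rewrite -JK mulr_suml; apply: eq_bigr => f _; ring.
  transitivity (\sum_f J c f * (\sum_d K d a * (\sum_e G d e f * X e)
     + \sum_b H f a b * X' b)); last first.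
    by rewrite -sumrB; apply: eq_bigr => f _; rewrite HX; ring.
  under eq_bigr do rewrite G'E mulr_suml.
  rewrite exchange_big /=; apply: eq_bigr => f _.
  transitivity (J c f * \sum_b (\sum_d \sum_e K d a * K e b * G d e f
      + H f a b) * X' b).
    by rewrite mulr_sumr; apply: eq_bigr => b _; ring.
  congr (_ * _).
  have -> : \sum_d K d a * \sum_e G d e f * X e
    = \sum_b (\sum_d \sum_e K d a * K e b * G d e f) * X' b.
    under [RHS]eq_bigr do rewrite mulr_suml.
    rewrite [RHS]exchange_big /=; apply: eq_bigr => d _.
    under [RHS]eq_bigr do rewrite mulr_suml.
    rewrite [RHS]exchange_big mulr_sumr /=; apply: eq_bigr => e _.
    by rewrite -KX !mulr_sumr; apply: eq_bigr => b _; ring.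
  by rewrite -big_split; apply: eq_bigr => b _ /=; ring.
transitivity (\sum_a \sum_f \sum_d J a f * K d a * xi d f).
  apply: eq_bigr => a _.
  transitivity (\sum_f (J a f * (\sum_d K d a * dX d f)
      + J a f * (\sum_d K d a * \sum_e G d e f * X e))).
    by rewrite GX dX'E !big_split /=; ring.
  apply: eq_bigr => f _.
  rewrite !mulr_sumr -big_split /=; apply: eq_bigr => d _.
  by rewrite /xi; ring.
rewrite exchange_big /=; apply: eq_bigr => f _.
rewrite exchange_big /= -/(xi f f) -(sum_delta (fun d => xi d f)).
apply: eq_bigr => d _; rewrite eq_sym -KJ mulr_suml.
by apply: eq_bigr => a _; ring.
Qed.

(** The contraction is the trace of $PS^T$; cyclicity of the trace brings the Jacobian next to its
    inverse. *)
Lemma pairing_change (P P' S S' : 'I_n -> 'I_n -> A) :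
  (forall a b, P' a b = \sum_c \sum_d K c a * K d b * P c d) ->
  (forall a b, S' a b = \sum_c \sum_d J a c * J b d * S c d) ->
  \sum_a \sum_b P' a b * S' a b = \sum_a \sum_b P a b * S a b.
Proof.
move=> P'E S'E.
pose j : 'M[A]_n := \matrix_(a, b) J a b; pose k : 'M[A]_n := \matrix_(a, b) K a b.
pose p : 'M[A]_n := \matrix_(a, b) P a b; pose s : 'M[A]_n := \matrix_(a, b) S a b.
have kj : k *m j = 1%:M.
  apply/matrixP => a b; rewrite !mxE -KJ.
  by apply: eq_bigr => e _; rewrite !mxE.
have p'E a b : P' a b = (k^T *m p *m k) a b.
  rewrite P'E exchange_big mxE; apply: eq_bigr => d _.
  by rewrite !mxE mulr_suml; apply: eq_bigr => c _; rewrite !mxE; ring.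
have s'E a b : S' a b = (j *m s *m j^T) a b.
  rewrite S'E exchange_big mxE; apply: eq_bigr => d _.
  by rewrite !mxE mulr_suml; apply: eq_bigr => c _; rewrite !mxE; ring.
have trE (x y : 'M[A]_n) : \sum_a \sum_b x a b * y a b = \tr (x *m y^T).
  by apply: eq_bigr => a _; rewrite mxE; apply: eq_bigr => b _; rewrite mxE.
transitivity (\tr ((k^T *m p *m k) *m (j *m s *m j^T)^T)).
  by rewrite -trE; apply: eq_bigr => a _; apply: eq_bigr => b _; rewrite p'E s'E.
transitivity (\tr (p *m s^T)); last first.
  by rewrite -trE; apply: eq_bigr => a _; apply: eq_bigr => b _; rewrite !mxE.
rewrite !trmx_mul trmxK !mulmxA -(mulmxA (k^T *m p)) kj mulmx1.
by rewrite -!mulmxA mxtrace_mulC -!mulmxA -trmx_mul kj trmx1 mulmx1.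
Qed.

End change_of_frame.

(** * The ring of smooth functions of a chart *)

Section chart_calculus.
Variables (R : realType) (n : nat) (M : oriented_manifold R n).
Implicit Types (i j : chart M) (f g : M -> R).

Lemma coord_icoord i y : (coord i @` dom i) y ->
  dom i (icoord i y) /\ coord i (icoord i y) = y.
Proof. by move=> [x xi <-]; rewrite coordK. Qed.

Lemma smooth_in_chart_eq i f g : (forall x, dom i x -> f x = g x) ->
  smooth_in_chart i f -> smooth_in_chart i g.
Proof.
move=> fg; apply: smooth_on_eq; first exact: image_open.
by move=> y /coord_icoord[yi _]; exact: fg.
Qed.

Lemma smooth_in_chart_cst i (c : R) : smooth_in_chart i (fun=> c).
Proof. by move=> k; apply: Ck_on_cst; exact: image_open. Qed.

Lemma smooth_in_chartD i f g : smooth_in_chart i f -> smooth_in_chart i g ->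
  smooth_in_chart i (fun x => f x + g x).
Proof. by move=> sf sg k; apply: Ck_onD; [exact: image_open|exact: sf|exact: sg]. Qed.

Lemma smooth_in_chartM i f g : smooth_in_chart i f -> smooth_in_chart i g ->
  smooth_in_chart i (fun x => f x * g x).
Proof. by move=> sf sg k; apply: Ck_onM; [exact: image_open|exact: sf|exact: sg]. Qed.

Lemma partialE i a f y : (coord i @` dom i) y ->
  partial i a f (icoord i y) = 'D_(basis_vec R a) (f \o icoord i) y.
Proof. by move=> /coord_icoord[_ E]; rewrite /partial E. Qed.

Lemma smooth_in_chart_partial i a f : smooth_in_chart i f ->
  smooth_in_chart i (partial i a f).
Proof.
move=> sf; apply: smooth_on_eq (smooth_on_derive a sf); first exact: image_open.
by move=> y yU; rewrite /= partialE.
Qed.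

Lemma partial_eq i a f g : (forall x, dom i x -> f x = g x) ->
  forall x, dom i x -> partial i a f x = partial i a g x.
Proof.
move=> fg x xi; apply: near_eq_derive.
apply: (@near_open_eq _ _ (coord i @` dom i)) => //; first exact: image_open.
by move=> y /coord_icoord[yi _] /=; exact: fg.
Qed.

Lemma partial_derivable i a f x : smooth_in_chart i f -> dom i x ->
  derivable (f \o icoord i) (coord i x) (basis_vec R a).
Proof. by move=> sf xi; apply: smooth_on_derivable sf _; exists x. Qed.

Lemma partial_cst i a c x : partial i a (fun=> c) x = 0.
Proof. exact: derive_cst. Qed.

Lemma partialB i a f g x : smooth_in_chart i f -> smooth_in_chart i g ->
  dom i x -> partial i a (fun y => f y - g y) x = partial i a f x - partial i a g x.
Proof. by move=> sf sg xi; apply: deriveB; exact: partial_derivable. Qed.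

Lemma partialM i a f g x : smooth_in_chart i f -> smooth_in_chart i g ->
  dom i x -> partial i a (fun y => f y * g y) x
             = partial i a f x * g x + f x * partial i a g x.
Proof.
move=> sf sg xi.
rewrite [LHS](deriveM (partial_derivable sf xi) (partial_derivable sg xi)).
by rewrite /= !coordK // addrC mulrC.
Qed.

(** Ring elements are functions on this subtype, so equality in the ring is equality on the domain
    of the chart. [extend] returns to functions on [M], as [partial] requires. *)
Definition chart_point i := {x : M | dom i x}.

Definition extend i (f : chart_point i -> R) : M -> R :=
  fun x => if pselect (dom i x) is left xi then f (exist _ x xi) else 0.

Lemma extendE i (f : chart_point i -> R) s : extend f (sval s) = f s.
Proof.
rewrite /extend; case: pselect => [xi|]; last by case: s.
by congr f; case: s xi => x xi xi'; congr exist; exact: Prop_irrelevance.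
Qed.

Lemma extend_eq i (f : chart_point i -> R) g :
  (forall s, f s = g (sval s)) -> forall x, dom i x -> g x = extend f x.
Proof. by move=> fg x xi; rewrite -[x]/(sval (exist _ x xi)) extendE fg. Qed.

Definition chart_smooth i : {pred chart_point i -> R} :=
  mem [set f | smooth_in_chart i (extend f)].
Arguments chart_smooth i : clear implicits.

Lemma chart_smooth_subring i : subring_closed (chart_smooth i).
Proof.
split=> [|f g|f g]; rewrite !inE /=.
- by apply: smooth_in_chart_eq (smooth_in_chart_cst i 1); exact: extend_eq.
- move=> sf sg.
  apply: smooth_in_chart_eq (smooth_in_chartD sf
    (smooth_in_chartM (smooth_in_chart_cst i (-1)) sg)).
  by apply: extend_eq => s; rewrite /= !extendE mulN1r.
- move=> sf sg; apply: smooth_in_chart_eq (smooth_in_chartM sf sg).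
  by apply: extend_eq => s; rewrite /= !extendE.
Qed.

Record chart_fun i := ChartFun {
  chart_fun_val :> chart_point i -> R ;
  chart_fun_smooth : chart_fun_val \in chart_smooth i
}.

HB.instance Definition _ i := [isSub of chart_fun i for (@chart_fun_val i)].
HB.instance Definition _ i := [Choice of chart_fun i by <:].
HB.instance Definition _ i := GRing.SubChoice_isSubComPzRing.Build
  (chart_point i -> R) (chart_smooth i) (chart_fun i) (@chart_smooth_subring i).

Definition value_at i (s : chart_point i) (F : chart_fun i) : R := F s.

Lemma chart_funP i (F H : chart_fun i) : 
  (forall s, value_at s F = value_at s H) -> F = H.
Proof. by move=> FH; apply: val_inj; apply/funext. Qed.

Lemma value_at_is_zmod_morphism i s : zmod_morphism (@value_at i s).
Proof. by []. Qed.

Lemma value_at_is_monoid_morphism i s : monoid_morphism (@value_at i s).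
Proof. by []. Qed.

HB.instance Definition _ i s := GRing.isZmodMorphism.Build
  (chart_fun i) R (@value_at i s) (@value_at_is_zmod_morphism i s).
HB.instance Definition _ i s := GRing.isMonoidMorphism.Build
  (chart_fun i) R (@value_at i s) (@value_at_is_monoid_morphism i s).

Lemma eval_sum i s (F : 'I_n -> chart_fun i) :
  value_at s (\sum_a F a) = \sum_a value_at s (F a).
Proof. exact: raddf_sum. Qed.

Lemma eval_nat i s k : value_at s (k%:R : chart_fun i) = k%:R.
Proof. exact: rmorph_nat. Qed.

Lemma evalD i s (F H : chart_fun i) : value_at s (F + H) = value_at s F + value_at s H.
Proof. exact: rmorphD. Qed.

Lemma evalB i s (F H : chart_fun i) : value_at s (F - H) = value_at s F - value_at s H.
Proof. exact: rmorphB. Qed.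

Lemma evalN i s (F : chart_fun i) : value_at s (- F) = - value_at s F.
Proof. exact: rmorphN. Qed.

Lemma evalM i s (F H : chart_fun i) : value_at s (F * H) = value_at s F * value_at s H.
Proof. exact: rmorphM. Qed.

Lemma eval0 i s : value_at s (0 : chart_fun i) = 0.
Proof. exact: rmorph0. Qed.

Definition evalE := (evalM, evalB, evalN, evalD, eval_sum, eval_nat, eval0).

(** The bridge between the tensor components, which are functions on all of [M], and the ring in
    which the identities are computed. *)
Definition represents i f (F : chart_fun i) : Prop :=
  forall s, f (sval s) = value_at s F.

Lemma representation i f : smooth_in_chart i f ->
  {F : chart_fun i | represents f F}.
Proof.
move=> sf; have H : (fun s => f (sval s)) \in chart_smooth i.
  by rewrite inE; apply: smooth_in_chart_eq sf; exact: extend_eq.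
by exists (ChartFun H).
Qed.

Lemma extend_smooth i (F : chart_fun i) : smooth_in_chart i (extend F).
Proof. by have := chart_fun_smooth F; rewrite inE. Qed.

Lemma represents_smooth i f (F : chart_fun i) : represents f F ->
  smooth_in_chart i f.
Proof.
move=> fF; apply: smooth_in_chart_eq (extend_smooth F) => x xi.
by rewrite -(extend_eq (g := f)).
Qed.

Definition chart_partial i a (F : chart_fun i) : chart_fun i :=
  sval (representation (smooth_in_chart_partial a (extend_smooth F))).

Lemma eval_chart_partial i a (F : chart_fun i) s :
  value_at s (chart_partial a F) = partial i a (extend F) (sval s).
Proof. by rewrite /chart_partial; case: representation => H /= ->. Qed.

Lemma represents_partial i a f (F : chart_fun i) : represents f F ->
  represents (partial i a f) (chart_partial a F).
Proof.
move=> fF s; rewrite eval_chart_partial; apply: partial_eq; last exact: svalP.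
by apply: extend_eq => t; rewrite fF.
Qed.

Lemma chart_partial_is_zmod_morphism i a : zmod_morphism (@chart_partial i a).
Proof.
move=> F H; apply: chart_funP => s; rewrite evalE.
rewrite !eval_chart_partial -partialB; [|exact: extend_smooth..|exact: svalP].
apply: partial_eq; last exact: svalP.
by move=> x xi; rewrite -[x]/(sval (exist _ x xi)) !extendE.
Qed.

HB.instance Definition _ i a := GRing.isZmodMorphism.Build
  (chart_fun i) (chart_fun i) (@chart_partial i a)
  (@chart_partial_is_zmod_morphism i a).

Lemma chart_partialM i a (F H : chart_fun i) :
  chart_partial a (F * H) = chart_partial a F * H + F * chart_partial a H.
Proof.
apply: chart_funP => s; rewrite !evalE.
rewrite !eval_chart_partial -[value_at s F]extendE -[value_at s H]extendE.
rewrite -partialM; [|exact: extend_smooth..|exact: svalP].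
apply: partial_eq; last exact: svalP.
by move=> x xi; rewrite -[x]/(sval (exist _ x xi)) !extendE.
Qed.

End chart_calculus.

Arguments value_at {R n M i} s F : simpl never.

(** * Connection and curvature in a chart *)

Section small_tuples.
Variable T : finType.

Lemma big_tuple0 (V : nmodType) (F : 0.-tuple T -> V) : \sum_u F u = F [tuple].
Proof.
rewrite (bigD1 [tuple]) //= big1 ?addr0 // => u /negP[].
by apply/eqP; exact: tuple0.
Qed.

Lemma big_tuple1 (V : nmodType) (F : 1.-tuple T -> V) :
  \sum_u F u = \sum_a F [tuple a].
Proof.
rewrite (reindex (fun a => [tuple a])) //=.
exists (@thead _ _) => u _; first by [].
by apply/val_inj; case: u => [[|a []]].
Qed.

Lemma big_tuple2 (V : nmodType) (F : 2.-tuple T -> V) :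
  \sum_u F u = \sum_a \sum_b F [tuple a; b].
Proof.
rewrite pair_big (reindex (fun ab : T * T => [tuple ab.1; ab.2])) //=.
exists (fun u : 2.-tuple T => (tnth u ord0, tnth u ord_max)) => u _.
  by case: u.
by apply/val_inj; case: u => [[|a [|b []]]].
Qed.

End small_tuples.

Section replace_index.
Variable n : nat.
Implicit Types a b c d : 'I_n.

Lemma replace_index1 c k d : replace_index [tuple c] k d = [tuple d].
Proof.
by apply: eq_from_tnth => l; rewrite tnth_mktuple !ord1.
Qed.

Lemma replace_index20 b c d : replace_index [tuple b; c] ord0 d = [tuple d; c].
Proof.
by apply: eq_from_tnth => l; rewrite tnth_mktuple; case: l => [[|[|]]].
Qed.

Lemma replace_index21 b c d :
  replace_index [tuple b; c] (lift ord0 ord0) d = [tuple b; d].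
Proof.
by apply: eq_from_tnth => l; rewrite tnth_mktuple; case: l => [[|[|]]].
Qed.

End replace_index.

Section chart_connection.
Variables (R : realType) (n : nat) (M : oriented_manifold R n).
Variables (D : connection M) (i : chart M).
Implicit Types (s : chart_point i) (a b c d : 'I_n).

Definition d_ a : {additive chart_fun i -> chart_fun i} := @chart_partial R n M i a.
Arguments d_ : simpl never.

Lemma d_M a (F H : chart_fun i) : d_ a (F * H) = d_ a F * H + F * d_ a H.
Proof. exact: chart_partialM. Qed.

Lemma d_d_nat a b (m : nat) : d_ a (d_ b m%:R) = 0.
Proof. by rewrite (pd_nat d_M) raddf0. Qed.

Lemma represents_d f (F : chart_fun i) a : represents f F ->
  represents (partial i a f) (d_ a F).
Proof. exact: represents_partial. Qed.

Definition Gam a b c : chart_fun i :=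
  sval (representation (christoffel_smooth D i a b c)).

Lemma eval_Gam s a b c : christoffel D i (sval s) a b c = value_at s (Gam a b c).
Proof. exact: (svalP (representation (christoffel_smooth D i a b c))). Qed.

Lemma Gam_sym : torsion_free D -> forall a b c, Gam a b c = Gam b a c.
Proof.
move=> tf a b c; apply: chart_funP => s; rewrite -!eval_Gam.
by apply: tf; exact: svalP.
Qed.

Lemma nabla10E (T : components M 1 0) (X : 'I_n -> chart_fun i) :
  (forall c, represents (fun x => T x [tuple c] [tuple]) (X c)) ->
  forall a c, represents (fun x => nabla D i T x [tuple c] [tuple a])
                         (cov10 d_ Gam X a c).
Proof.
move=> TX a c s; rewrite /nabla /cov10 !evalE.
have -> : [tuple of behead [tuple a]] = [tuple] :> 0.-tuple 'I_n.
  exact: tuple0.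
rewrite big_ord_recl !big_ord0 addr0 subr0 /=; congr (_ + _).
  exact: represents_d (TX c) s.
apply: eq_bigr => d _; rewrite replace_index1 !evalE -eval_Gam -TX.
by [].
Qed.

Lemma nabla11E (T : components M 1 1) (E : 'I_n -> 'I_n -> chart_fun i) :
  (forall b c, represents (fun x => T x [tuple c] [tuple b]) (E b c)) ->
  forall a b c, represents (fun x => nabla D i T x [tuple c] [tuple a; b])
                           (cov11 d_ Gam E a b c).
Proof.
move=> TE a b c s; rewrite /nabla /cov11 !evalE.
have -> : [tuple of behead [tuple a; b]] = [tuple b] by exact: val_inj.
rewrite !big_ord_recl !big_ord0 !addr0 /=; congr (_ + _ - _).
- exact: represents_d (TE b c) s.
- by apply: eq_bigr => d _; rewrite replace_index1 !evalE -eval_Gam -TE.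
- by apply: eq_bigr => d _; rewrite replace_index1 !evalE -eval_Gam -TE.
Qed.

Lemma nabla20E (T : components M 2 0) (S : 'I_n -> 'I_n -> chart_fun i) :
  (forall b c, represents (fun x => T x [tuple b; c] [tuple]) (S b c)) ->
  forall a b c, represents (fun x => nabla D i T x [tuple b; c] [tuple a])
                           (cov20 d_ Gam S a b c).
Proof.
move=> TS a b c s; rewrite /nabla /cov20 !evalE.
have -> : [tuple of behead [tuple a]] = [tuple] :> 0.-tuple 'I_n.
  exact: tuple0.
rewrite !big_ord_recl !big_ord0 !addr0 subr0 /= addrA; congr (_ + _ + _).
- exact: represents_d (TS b c) s.
- by apply: eq_bigr => d _; rewrite replace_index20 !evalE -eval_Gam -TS.
- by apply: eq_bigr => d _; rewrite replace_index21 !evalE -eval_Gam -TS.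
Qed.

Lemma nabla02E (T : components M 0 2) (P : 'I_n -> 'I_n -> chart_fun i) :
  (forall b c, represents (fun x => T x [tuple] [tuple b; c]) (P b c)) ->
  forall a b c, represents (fun x => nabla D i T x [tuple] [tuple a; b; c])
                           (cov02 d_ Gam P a b c).
Proof.
move=> TP a b c s; rewrite /nabla /cov02 !evalE.
have -> : [tuple of behead [tuple a; b; c]] = [tuple b; c] by exact: val_inj.
rewrite !big_ord_recl !big_ord0 !addr0 /= opprD addrA; congr (_ - _ - _).
- exact: represents_d (TP b c) s.
- by apply: eq_bigr => d _; rewrite replace_index20 !evalE -eval_Gam -TP.
- by apply: eq_bigr => d _; rewrite replace_index21 !evalE -eval_Gam -TP.
Qed.

Lemma second_nablaE (T : components M 1 0) (X : 'I_n -> chart_fun i) :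
  (forall c, represents (fun x => T x [tuple c] [tuple]) (X c)) ->
  forall a b c,
    represents (fun x => nabla D i (nabla D i T) x [tuple c] [tuple a; b])
               (cov11 d_ Gam (cov10 d_ Gam X) a b c).
Proof. by move=> TX; apply: nabla11E => b c; exact: nabla10E. Qed.

Lemma components_of (X : 'I_n -> chart_fun i) :
  exists2 T : components M 1 0, smooth_components i T &
    forall c, represents (fun x => T x [tuple c] [tuple]) (X c).
Proof.
exists (fun x u _ => extend (X (thead u)) x).
  by move=> u v; exact: extend_smooth.
by move=> c s; rewrite extendE.
Qed.

Lemma tensor_representation p q (T : tensor M p q) : tensor_field T ->
  exists F : p.-tuple 'I_n -> q.-tuple 'I_n -> chart_fun i,
    forall u v, represents (fun x => T i x u v) (F u v).
Proof.
move=> [sT _ _]; exists (fun u v => sval (representation (sT i u v))) => u v.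
exact: (svalP (representation (sT i u v))).
Qed.

Section curvature.
Hypothesis D_torsion_free : torsion_free D.
Variables (k : nat) (nk : n = k.+1) (k_gt0 : (0 < k)%N).
Variables (P : tensor M 0 2) (P_schouten : is_schouten D P).
Variables (W : tensor M 1 3) (W_weyl : is_weyl D P W).
Variables (Pf : 'I_n -> 'I_n -> chart_fun i).
Hypothesis PfE : forall a b,
  represents (fun x => P i x [tuple] [tuple a; b]) (Pf a b).
Variables (Wf : 'I_n -> 'I_n -> 'I_n -> 'I_n -> chart_fun i).
Hypothesis WfE : forall a b c d,
  represents (fun x => W i x [tuple c] [tuple a; b; d]) (Wf a b c d).

Let Gsym := Gam_sym D_torsion_free.

(** Equate the Ricci identity with the defining equation of [W], the commutator of the coordinate
    derivations being still present. *)
Lemma weyl_identity X a b c :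
  d_ a (d_ b (X c)) - d_ b (d_ a (X c))
  + \sum_d curv d_ Gam a b c d * X d
  = \sum_d (Wf a b c d + (a == c)%:R * Pf b d - (b == c)%:R * Pf a d) * X d.
Proof.
have [T sT TX] := components_of X.
rewrite -(ricci_identity d_M Gsym); apply: chart_funP => s.
rewrite evalB eval_sum.
rewrite -!(second_nablaE TX) /= (W_weyl.2 i T sT _ (svalP s)).
rewrite /delta !mulr_sumr -big_split -sumrB; apply: eq_bigr => d _ /=.
rewrite !evalE -TX -PfE -PfE -WfE /=; ring.
Qed.

Lemma curv_weyl a b c d : curv d_ Gam a b c d
  = Wf a b c d + (a == c)%:R * Pf b d - (b == c)%:R * Pf a d.
Proof.
(* The coordinate field in direction [d] has constant components, so its derivatives vanish and both
   sums reduce to one coefficient. *)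
have := weyl_identity (fun e => (d == e)%:R) a b c.
by rewrite /= !d_d_nat subrr add0r !sum_delta'.
Qed.

Lemma d_C a b (F : chart_fun i) : d_ a (d_ b F) = d_ b (d_ a F).
Proof.
(* Every component of the test field is [F], and the upper index [a] is an arbitrary choice. The
   zeroth-order terms agree by [curv_weyl], which leaves the commutator on [F]. *)
have := weyl_identity (fun=> F) a b a.
have -> : \sum_e curv d_ Gam a b a e * F
  = \sum_d (Wf a b a d + (a == a)%:R * Pf b d - (b == a)%:R * Pf a d) * F.
  by apply: eq_bigr => d _; rewrite curv_weyl.
by move=> /eqP; rewrite -subr_eq0 addrK subr_eq0 => /eqP.
Qed.

Lemma ric_schouten a b : ric d_ Gam a b = k%:R * Pf a b.
Proof.
have [Ric [Ric_tensor RicE] PRic] := P_schouten.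
(* Testing the definition of the Ricci tensor on a coordinate field isolates one component. *)
have [T sT TX] := components_of (fun e => (b == e)%:R).
apply: chart_funP => s.
have nR : n%:R - 1 = k%:R :> R by rewrite nk -natr1 addrK.
have k0 : k%:R != 0 :> R by rewrite pnatr_eq0 -lt0n.
have -> : value_at s (k%:R * Pf a b) = Ric i (sval s) [tuple] [tuple a; b].
  by rewrite !evalE -PfE PRic nR mulrA divff ?mul1r.
have -> : Ric i (sval s) [tuple] [tuple a; b]
  = \sum_d Ric i (sval s) [tuple] [tuple a; d] * T (sval s) [tuple d] [tuple].
  rewrite -[LHS](sum_delta' (fun d => Ric i (sval s) [tuple] [tuple a; d])).
  by apply: eq_bigr => d _; rewrite TX evalE.
rewrite -(RicE i T sT _ (svalP s)) /ric evalE; apply: eq_bigr => c _.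
rewrite !(second_nablaE TX) -evalB (ricci_identity d_M Gsym).
by rewrite !d_d_nat subrr add0r sum_delta'.
Qed.

End curvature.
End chart_connection.

Arguments d_ {R n M i} a : simpl never.

(** * Parallel volume form, trace of the curvature and symmetry of the Schouten tensor *)

Section volume.
Variables (R : realType) (n : nat) (M : oriented_manifold R n).
Variables (D : connection M) (i : chart M).
Implicit Types (s : chart_point i) (a b c d : 'I_n) (eps : tensor M 0 n).

Lemma volume_form_repeated eps x (v : n.-tuple 'I_n) k l : volume_form eps ->
  dom i x -> k != l -> tnth v k = tnth v l -> eps i x [tuple] v = 0.
Proof.
move=> [_ eps_alt _] xi kl vkl.
have := eps_alt i x xi v (tperm k l); rewrite odd_tperm kl expr1 mulN1r.
have -> : [tuple tnth v (tperm k l m) | m < n] = v.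
  by apply: eq_from_tnth => m; rewrite tnth_mktuple; case: tpermP => // ->.
by move=> E; lra.
Qed.

(** Some component is nonzero; its indices are then distinct, hence a permutation of the standard
    ordering, and alternation changes only the sign. *)
Lemma volume_form_neq0 eps x : volume_form eps -> dom i x ->
  eps i x [tuple] (ord_tuple n) != 0.
Proof.
move=> eps_vol xi; have [_ eps_alt /(_ i x xi)[v v0]] := eps_vol.
have v_inj : injective (tnth v).
  move=> k l vkl; apply/eqP; apply: contraNT v0 => kl.
  by apply/eqP; exact: volume_form_repeated kl vkl.
apply: contraNneq v0 => e0.
have -> : v = [tuple tnth (ord_tuple n) (perm v_inj k) | k < n].
  by apply: eq_from_tnth => k; rewrite tnth_mktuple tnth_ord_tuple permE.
by rewrite eps_alt // e0 mulr0.
Qed.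

(** Take the component with indices in standard order. Replacing its [k]-th index by another one
    creates a repetition, so only the diagonal Christoffel symbols survive. *)
Lemma parallel_volume_form eps : volume_form eps ->
  (forall x, dom i x -> forall v, nabla D i (eps i) x [tuple] v = 0) ->
  exists2 F : chart_fun i, (forall s, value_at s F != 0) &
    forall a, d_ a F = (\sum_c Gam D i a c c) * F.
Proof.
move=> eps_vol eps_par.
have eps_tensor : tensor_field eps by case: eps_vol.
have [F FE] := tensor_representation i eps_tensor.
exists (F [tuple] (ord_tuple n)) => [s|a].
  by rewrite -FE; apply: volume_form_neq0 => //; exact: svalP.
apply: chart_funP => s; have xi := svalP s.
have := eps_par _ xi [tuple of a :: ord_tuple n]; rewrite /nabla.
have -> : [tuple of behead [tuple of a :: ord_tuple n]] = ord_tuple n.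
  exact: val_inj.
rewrite big_ord0 addr0 theadE (represents_d a (FE _ _)) => /eqP.
rewrite subr_eq0 => /eqP ->.
rewrite evalM eval_sum mulr_suml; apply: eq_bigr => k _.
rewrite (bigD1 k) //= [X in _ + X]big1 ?addr0 => [|d dk].
  rewrite tnth_ord_tuple eval_Gam -FE; congr (_ * eps i _ _ _).
  apply: eq_from_tnth => l; rewrite tnth_mktuple tnth_ord_tuple.
  by case: eqP => // ->.
rewrite [X in _ * X](@volume_form_repeated _ _ _ k d) ?mulr0 //.
  by rewrite eq_sym.
by rewrite !tnth_mktuple eqxx (negbTE dk) tnth_ord_tuple.
Qed.

Section symmetry.
Hypothesis D_torsion_free : torsion_free D.
Hypothesis D_special : special D.
Hypothesis dC : forall a b (F : chart_fun i), d_ a (d_ b F) = d_ b (d_ a F).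

Lemma curv_trace0 a b : \sum_c curv d_ (Gam D i) a b c c = 0.
Proof.
have [eps [eps_vol eps_par]] := D_special.
have [F F0 dF] := parallel_volume_form eps_vol (eps_par i).
(* The product vanishes in the ring; [F] has no zeros, so it can be cancelled at each point. *)
have H := curv_trace_annihilates (@d_M _ _ _ i) dC dF a b.
apply: chart_funP => s; move/(congr1 (value_at s)): H.
rewrite evalM eval0 => /eqP; rewrite mulf_eq0 (negbTE (F0 s)) orbF.
by move=> /eqP.
Qed.

Lemma schouten_sym k (P : 'I_n -> 'I_n -> chart_fun i) : (0 < k)%N ->
  (forall a b, ric d_ (Gam D i) a b = k%:R * P a b) ->
  forall a b, P a b = P b a.
Proof.
move=> k0 ricP a b; apply: chart_funP => s.
have := ric_skew d_ (Gam_sym i D_torsion_free) a b.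
rewrite curv_trace0 oppr0 !ricP => /(congr1 (value_at s)) /eqP.
rewrite evalB !evalM eval0 eval_nat -mulrBr mulf_eq0 pnatr_eq0 -leqn0 leqNgt k0.
by rewrite subr_eq0 => /eqP.
Qed.

End symmetry.
End volume.

(** * Change of chart *)

Section tensor_transformation.
Variables (R : realType) (n : nat) (M : oriented_manifold R n).
Variables (i j : chart M) (x : M) (xi : dom i x) (xj : dom j x).
Implicit Types (a b c d : 'I_n).

Lemma tensor_field10 (T : tensor M 1 0) : tensor_field T -> forall b,
  T j x [tuple b] [tuple]
  = \sum_e partial i e (xcoord j b) x * T i x [tuple e] [tuple].
Proof.
move=> [_ TT _] b; rewrite (TT i j x xi xj) big_tuple1; apply: eq_bigr => e _.
by rewrite big_tuple0 big_ord_recl !big_ord0 !mulr1.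
Qed.

Lemma tensor_field20 (T : tensor M 2 0) : tensor_field T -> forall a b,
  T j x [tuple a; b] [tuple]
  = \sum_c \sum_d partial i c (xcoord j a) x * partial i d (xcoord j b) x
      * T i x [tuple c; d] [tuple].
Proof.
move=> [_ TT _] a b; rewrite (TT i j x xi xj) big_tuple2.
apply: eq_bigr => c _; apply: eq_bigr => d _.
by rewrite big_tuple0 !big_ord_recl !big_ord0 !mulr1.
Qed.

Lemma tensor_field02 (T : tensor M 0 2) : tensor_field T -> forall a b,
  T j x [tuple] [tuple a; b]
  = \sum_c \sum_d partial j a (xcoord i c) x * partial j b (xcoord i d) x
      * T i x [tuple] [tuple c; d].
Proof.
move=> [_ TT _] a b; rewrite (TT i j x xi xj) big_tuple0 big_tuple2.
apply: eq_bigr => c _; apply: eq_bigr => d _.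
by rewrite !big_ord_recl !big_ord0 !mulr1 mul1r.
Qed.

End tensor_transformation.

Section chart_change.
Variables (R : realType) (n : nat) (M : oriented_manifold R n).
Implicit Types (i j : chart M) (f g : M -> R) (x : M) (a b c d : 'I_n).
Local Notation e_ := (basis_vec R).

Definition overlap i j := coord i @` (dom i `&` dom j).

Lemma overlap_open i j : open (overlap i j).
Proof.
rewrite openE => y [p [ip jp] <-]; rewrite /interior.
have ni : nbhs (coord i p) (coord i @` dom i).
  by apply: open_nbhs_nbhs; split; [exact: image_open|exists p].
have nj : nbhs (coord i p) (icoord i @^-1` dom j).
  apply: icoord_continuous => //; apply: open_nbhs_nbhs.
  by split; [exact: dom_open|rewrite coordK].
apply: filterS (filterI ni nj) => z [[q iq <-]] /=.
by rewrite coordK // => jq; exists q.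
Qed.

Lemma overlap_coord i j x : dom i x -> dom j x -> overlap i j (coord i x).
Proof. by move=> ix jx; exists x. Qed.

Lemma icoord_overlap i j y : overlap i j y ->
  [/\ dom i (icoord i y), dom j (icoord i y) & coord i (icoord i y) = y].
Proof. by move=> [p [ip jp] <-]; rewrite coordK. Qed.

Lemma near_overlap i j f g x : dom i x -> dom j x ->
  (forall y, dom i y -> dom j y -> f y = g y) ->
  \forall y \near coord j x, (f \o icoord j) y = (g \o icoord j) y.
Proof.
move=> ix jx fg.
apply: (@near_open_eq _ _ (overlap j i)); first exact: overlap_open.
  by move=> y /icoord_overlap[jy iy _] /=; exact: fg.
exact: overlap_coord.
Qed.

Lemma partial_overlap_eq i j f g x a : dom i x -> dom j x ->
  (forall y, dom i y -> dom j y -> f y = g y) ->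
  partial j a f x = partial j a g x.
Proof. by move=> ix jx fg; apply: near_eq_derive; exact: near_overlap ix jx fg. Qed.

Definition smooth_on_overlap i j f := smooth_on (overlap i j) (f \o icoord i).

Lemma smooth_in_chart_overlap i j f :
  smooth_in_chart i f -> smooth_on_overlap i j f.
Proof.
have W k (U V : set 'rV[R]_n) h : U `<=` V -> Ck_on k V h -> Ck_on k U h.
  move=> UV; elim: k h => [|k IH] h [ch dh]; split => //.
  - by move=> y /UV; exact: ch.
  - by move=> y /UV; exact: ch.
  - by move=> b; have [d1 d2] := dh b; split; [move=> y /UV; exact: d1|exact: IH].
move=> sf k; apply: W (sf k) => _ [p [ip _] <-]; by exists p.
Qed.

Lemma smooth_xcoord i j a : smooth_on_overlap i j (xcoord j a).
Proof. exact: transition_smooth. Qed.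

Lemma smooth_overlap_partial i j a f : smooth_on_overlap i j f ->
  smooth_on_overlap i j (partial i a f).
Proof.
move=> sf; apply: smooth_on_eq (smooth_on_derive a sf); first exact: overlap_open.
by move=> y /icoord_overlap[_ _ E]; rewrite /= /partial E.
Qed.

(** Near the point, [f] read in the chart [j] is [f] read in [i] composed with the transition map.
    The form [is_derive] also provides derivability in [j] of functions given as smooth in [i]. *)
Lemma partial_chain i j f x a : dom i x -> dom j x -> smooth_on_overlap i j f ->
  is_derive (coord j x) (e_ a) (f \o icoord j)
    (\sum_b partial j a (xcoord i b) x * partial i b f x).
Proof.
move=> ix jx sf; pose phi y := coord i (icoord j y).
have phix : phi (coord j x) = coord i x by rewrite /phi coordK.
have dphi b : derivable (fun y => phi y 0 b) (coord j x) (e_ a).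
  exact: smooth_on_derivable (@smooth_xcoord j i b) (overlap_coord jx ix).
have df : differentiable (f \o icoord i) (phi (coord j x)).
  rewrite phix; apply: smooth_on_differentiable sf _; first exact: overlap_open.
  exact: overlap_coord.
have := is_derive_comp_rV dphi df; rewrite phix.
apply: near_eq_is_derive.
apply: (@near_open_eq _ _ (overlap j i)); first exact: overlap_open.
  by move=> y /icoord_overlap[jy iy _] /=; rewrite /phi coordK.
exact: overlap_coord.
Qed.

Lemma partial_chainE i j f x a : dom i x -> dom j x -> smooth_on_overlap i j f ->
  partial j a f x = \sum_b partial j a (xcoord i b) x * partial i b f x.
Proof.
move=> ix jx sf; have H := partial_chain a ix jx sf.
exact: derive_val.
Qed.

Lemma partial_xcoord i x a b : dom i x -> partial i a (xcoord i b) x = (b == a)%:R.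
Proof.
move=> ix; transitivity ('D_(e_ a) (fun y : 'rV[R]_n => y 0 b) (coord i x)).
  apply: near_eq_derive.
  apply: (@near_open_eq _ _ (overlap i i)); first exact: overlap_open.
    by move=> y /icoord_overlap[_ _ E] /=; rewrite /xcoord E.
  exact: overlap_coord.
have did : derivable (id : 'rV[R]_n -> 'rV[R]_n) (coord i x) (e_ a).
  exact: derivable_id.
have := derive_mx did.
by rewrite derive_id => /rowP /(_ b); rewrite !mxE eqxx => <-.
Qed.

Lemma jacobian_inverse i j x a b : dom i x -> dom j x ->
  \sum_e partial i e (xcoord j a) x * partial j b (xcoord i e) x = (a == b)%:R.
Proof.
move=> ix jx; rewrite -(partial_xcoord b a jx) (partial_chainE b ix jx).
  by apply: eq_bigr => e _; rewrite mulrC.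
exact: smooth_xcoord.
Qed.

Lemma partial_sumM i a x (f g : 'I_n -> M -> R) : dom i x ->
  (forall c, derivable (f c \o icoord i) (coord i x) (e_ a)) ->
  (forall c, derivable (g c \o icoord i) (coord i x) (e_ a)) ->
  partial i a (fun y => \sum_c f c y * g c y) x
  = \sum_c (partial i a (f c) x * g c x + f c x * partial i a (g c) x).
Proof.
move=> ix df dg; rewrite /partial.
have -> : (fun y => \sum_c f c y * g c y) \o icoord i
  = \sum_c ((f c \o icoord i) * (g c \o icoord i)).
  by apply/funext => y; rewrite fct_sumE.
rewrite derive_sum => [|c]; last exact: derivableM.
apply: eq_bigr => c _; rewrite deriveM //= coordK //.
by rewrite addrC /GRing.scale /= [X in X + _]mulrC.
Qed.

Section overlap_point.
Variables (i j : chart M) (x : M) (ix : dom i x) (jx : dom j x).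

(** Differentiate the relation between the Jacobian and its inverse, whose right-hand side is
    constant on the overlap. This supplies the hypothesis [HL] of [divergence_change]. *)
Lemma inverse_jacobian_derivative a (f e : 'I_n) :
  \sum_c (partial j a (partial j c (xcoord i f)) x * partial i e (xcoord j c) x
     + partial j c (xcoord i f) x * partial j a (partial i e (xcoord j c)) x) = 0.
Proof.
rewrite -(@partial_sumM j a x (fun c => partial j c (xcoord i f))
            (fun c => partial i e (xcoord j c))) //.
- rewrite (partial_overlap_eq (i := i) (g := fun=> (f == e)%:R)) //.
    exact: partial_cst.
  by move=> y iy jy; exact: jacobian_inverse.
- move=> c; apply: smooth_on_derivable (overlap_coord jx ix).
  by apply: smooth_overlap_partial; exact: smooth_xcoord.
- move=> c; have [//] := partial_chain a ix jx
    (smooth_overlap_partial e (@smooth_xcoord i j c)).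
Qed.

Lemma pairing_chart (P : tensor M 0 2) (S : tensor M 2 0) :
  tensor_field P -> tensor_field S ->
  \sum_a \sum_b P j x [tuple] [tuple a; b] * S j x [tuple a; b] [tuple]
  = \sum_a \sum_b P i x [tuple] [tuple a; b] * S i x [tuple a; b] [tuple].
Proof.
move=> tP tS.
have KJ a b : \sum_e partial j e (xcoord i a) x * partial i b (xcoord j e) x
    = (a == b)%:R by exact: jacobian_inverse.
exact: (pairing_change (J := fun b e => partial i e (xcoord j b) x)
  (K := fun c a => partial j a (xcoord i c) x) KJ
  (tensor_field02 ix jx tP) (tensor_field20 ix jx tS)).
Qed.

Lemma nabla10 (D : connection M) k (T : components M 1 0) y a c :
  nabla D k T y [tuple c] [tuple a]
  = partial k a (fun z => T z [tuple c] [tuple]) y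
    + \sum_d christoffel D k y a d c * T y [tuple d] [tuple].
Proof.
rewrite /nabla.
have -> : [tuple of behead [tuple a]] = [tuple] :> 0.-tuple 'I_n.
  exact: tuple0.
rewrite big_ord_recl !big_ord0 addr0 subr0; congr (_ + _).
by apply: eq_bigr => d _; rewrite replace_index1.
Qed.

Lemma divergence_chart (D : connection M) (X : tensor M 1 0) : tensor_field X ->
  \sum_a nabla D j (X j) x [tuple a] [tuple a]
  = \sum_a nabla D i (X i) x [tuple a] [tuple a].
Proof.
move=> tX.
have sX e : smooth_on_overlap i j (fun y => X i y [tuple e] [tuple]).
  by apply: smooth_in_chart_overlap; case: tX => sX _ _; exact: sX.
under eq_bigr do rewrite nabla10.
under [RHS]eq_bigr do rewrite nabla10.
have JK a b : \sum_e partial i e (xcoord j a) x * partial j b (xcoord i e) x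
    = (a == b)%:R by exact: jacobian_inverse.
have KJ a b : \sum_e partial j e (xcoord i a) x * partial i b (xcoord j e) x
    = (a == b)%:R by exact: jacobian_inverse.
apply: (divergence_change JK KJ inverse_jacobian_derivative
  (G := christoffel D i x) (G' := christoffel D j x)
  (X := fun b => X i x [tuple b] [tuple])
  (X' := fun b => X j x [tuple b] [tuple])
  (dX := fun a b => partial i a (fun z => X i z [tuple b] [tuple]) x)
  (dX' := fun a b => partial j a (fun z => X j z [tuple b] [tuple]) x)).
- by move=> a b c; exact: christoffel_transform.
- by move=> b; exact: tensor_field10.
- move=> a b.
  rewrite (partial_overlap_eq (i := i)
    (g := fun y => \sum_e partial i e (xcoord j b) y * X i y [tuple e] [tuple])) //;
    last by move=> y iy jy; exact: tensor_field10.
  rewrite partial_sumM //.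
  + by apply: eq_bigr => e _; rewrite (partial_chainE a ix jx (sX e)).
  + by move=> e; have [//] := partial_chain a ix jx
      (smooth_overlap_partial e (@smooth_xcoord i j b)).
  + by move=> e; have [//] := partial_chain a ix jx (sX e).
Qed.

End overlap_point.
End chart_change.

(** * Prolongation *)

Section prolongation.
Variables (R : realType) (n : nat) (M : oriented_manifold R n) (D : connection M).
Implicit Types (i : chart M) (a b c d : 'I_n).

Section trace.
Variables (P : tensor M 0 2) (sigma : tensor M 2 0) (mu : tensor M 1 0).

(** The value of $\rho$ forced by the trace of the second tractor equation, where the Weyl term
    vanishes. *)
Definition local_rho i x : R :=
  n%:R^-1 * (\sum_a nabla D i (mu i) x [tuple a] [tuple a]
    + \sum_a \sum_b P i x [tuple] [tuple a; b] * sigma i x [tuple a; b] [tuple]).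

(** A chart is chosen separately at each point; [global_rhoE] replaces it by any fixed chart, from
    which smoothness follows. *)
Definition global_rho (x : M) : R := local_rho (sval (cid (dom_cover x))) x.

Lemma global_rhoE : tensor_field P -> tensor_field sigma -> tensor_field mu ->
  forall i x, dom i x -> global_rho x = local_rho i x.
Proof.
move=> tP tS tX i x xi; rewrite /global_rho; case: cid => j xj /=.
by rewrite /local_rho (divergence_chart xi xj) // (pairing_chart xi xj).
Qed.

End trace.

Lemma metrizability_trace (sigma : tensor M 2 0) (mu : tensor M 1 0) i x :
  (forall a b c, nabla D i (sigma i) x [tuple b; c] [tuple a]
     = delta R a b * mu i x [tuple c] [tuple]
       + delta R a c * mu i x [tuple b] [tuple]) ->
  forall c, n.+1%:R * mu i x [tuple c] [tuple]
    = \sum_a nabla D i (sigma i) x [tuple a; c] [tuple a].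
Proof.
move=> H c; transitivity (\sum_a (mu i x [tuple c] [tuple]
    + (c == a)%:R * mu i x [tuple a] [tuple])); last first.
  by apply: eq_bigr => a _; rewrite H /delta (eqxx a) mul1r (eq_sym a).
rewrite big_split /= (sum_delta (fun a => mu i x [tuple a] [tuple])).
by rewrite sumr_const card_ord -mulr_natl -natr1; ring.
Qed.

(** * Construction of a parallel section from a solution *)

Section surjectivity.
Hypothesis n_ge2 : (2 <= n)%N.
Hypothesis D_torsion_free : torsion_free D.
Hypothesis D_special : special D.
Variables (P : tensor M 0 2) (P_schouten : is_schouten D P).
Variables (W : tensor M 1 3) (W_weyl : is_weyl D P W).
Variables (sigma : tensor M 2 0) (mu : tensor M 1 0).
Hypothesis sigma_sym : symmetric_bivector sigma.
Hypothesis mu_tensor : tensor_field mu.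
Hypothesis sigma_mu : forall i x, dom i x -> forall a b c,
  nabla D i (sigma i) x [tuple b; c] [tuple a]
  = delta R a b * mu i x [tuple c] [tuple]
    + delta R a c * mu i x [tuple b] [tuple].

(** [is_schouten] gives [P] as a multiple of the Ricci tensor, from which smoothness, the
    transformation law and the zero values off the chart are inherited. *)
Lemma schouten_tensor_field : tensor_field P.
Proof.
have [Ric [[sRic tRic zRic] _] PRic] := P_schouten.
split.
- move=> i u v; apply: smooth_in_chart_eq (smooth_in_chartM
    (smooth_in_chart_cst i (n%:R - 1)^-1) (sRic i u v)).
  by move=> x _; rewrite PRic.
- move=> i j x ix jx u v; rewrite PRic (tRic i j) // mulr_sumr.
  apply: eq_bigr => u' _; rewrite mulr_sumr; apply: eq_bigr => v' _.
  by rewrite PRic; ring.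
- by move=> i x ix u v; rewrite PRic zRic // mulr0.
Qed.

Let rho := global_rho P sigma mu.

Lemma prolongation_in_chart i :
  smooth_in_chart i rho /\
  forall x, dom i x -> let s := Tractor sigma mu rho in
  [/\ forall a b c, tractor_nabla_sigma D s i x a b c = 0,
      forall a b, tractor_nabla_mu D P W s i x a b = 0
    & forall a, tractor_nabla_rho D P s i x a = 0].
Proof.
(* The assumption $n\geq 2$ makes [k] nonzero, so that $(n-1)^{-1}$ and the factor left in
   [prolongation_rho] can be cancelled. *)
have [k nk] : {k | n = k.+1} by exists n.-1; rewrite prednK // ltnW.
have k_gt0 : (0 < k)%N by rewrite -ltnS -nk.
have k_neq0 : k%:R != 0 :> R by rewrite pnatr_eq0 -lt0n.
have n_neq0 : n%:R != 0 :> R by rewrite pnatr_eq0 nk.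
have tP := schouten_tensor_field; have [tS sS] := sigma_sym.
have [tW _] := W_weyl.
have [P0 P0E] := tensor_representation i tP.
have [W0 W0E] := tensor_representation i tW.
have [S0 S0E] := tensor_representation i tS.
have [X0 X0E] := tensor_representation i mu_tensor.
pose Pf a b := P0 [tuple] [tuple a; b].
have PfE a b : represents (fun x => P i x [tuple] [tuple a; b]) (Pf a b).
  exact: P0E.
pose Wf a b c d := W0 [tuple c] [tuple a; b; d].
have WfE a b c d :
  represents (fun x => W i x [tuple c] [tuple a; b; d]) (Wf a b c d).
  exact: W0E.
pose S a b := S0 [tuple a; b] [tuple].
have SE a b : represents (fun x => sigma i x [tuple a; b] [tuple]) (S a b).
  exact: S0E.
pose X a := X0 [tuple a] [tuple].
have XE a : represents (fun x => mu i x [tuple a] [tuple]) (X a) by exact: X0E.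
(* The constant function $1/n$ stands in for division in the ring. [F] is $n\rho$, introduced
   through an equation so that it stays folded. *)
have [C CE] := representation (smooth_in_chart_cst i (n%:R^-1 : R)).
have [F FE] : {F | F = divergence d_ (Gam D i) X + \sum_b \sum_c Pf b c * S b c}.
  by eexists.
have rhoE : represents rho (C * F).
  move=> s; rewrite /rho (global_rhoE tP tS mu_tensor (svalP s)) evalM -CE.
  congr (_ * _); rewrite FE evalD !eval_sum; congr (_ + _).
    by apply: eq_bigr => a _; rewrite (nabla10E D XE).
  apply: eq_bigr => a _; rewrite eval_sum; apply: eq_bigr => b _.
  by rewrite evalM -PfE -SE.
have FC : F = n%:R * (C * F).
  by apply: chart_funP => s; rewrite !evalM eval_nat -CE mulrA divff ?mul1r.
have SX a b c : cov20 d_ (Gam D i) S a b c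
    = (a == b)%:R * X c + (a == c)%:R * X b.
  apply: chart_funP => s; rewrite -(nabla20E D SE) sigma_mu; last exact: svalP.
  by rewrite evalD !evalM !eval_nat -!XE.
have Ssym b c : S b c = S c b.
  by apply: chart_funP => s; rewrite -!SE; apply: sS; exact: svalP.
have Gsym := Gam_sym i D_torsion_free.
have curvW := curv_weyl D_torsion_free W_weyl PfE WfE.
have dC := d_C D_torsion_free W_weyl PfE WfE.
have ricP := ric_schouten D_torsion_free nk k_gt0 P_schouten PfE.
have tr0 := curv_trace0 D_special dC.
have Psym := schouten_sym D_torsion_free D_special dC k_gt0 ricP.
split; first exact: represents_smooth rhoE.
move=> x ix T; pose s : chart_point i := exist _ x ix.
split=> [a b c|a b|a].
- by rewrite /tractor_nabla_sigma sigma_mu //=; ring.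
- have := prolongation_mu_weyl (@d_M _ _ _ i) Gsym dC SX Ssym nk ricP a b curvW.
  rewrite -FE => /(congr1 (value_at s)).
  rewrite evalM eval_nat -(nabla10E D XE) evalD evalB !evalM !eval_nat !eval_sum.
  rewrite {1}FC evalM eval_nat -rhoE /= => E.
  rewrite /tractor_nabla_mu /delta /=; apply: (mulfI n_neq0).
  move: (nabla D i (mu i) x [tuple b] [tuple a]) (rho x) E => N r E.
  rewrite mulr0 !(mulrBr, mulrDr) E (mulrA n%:R n%:R^-1) divff // mul1r.
  have -> : \sum_c P i x [tuple] [tuple a; c] * sigma i x [tuple b; c] [tuple]
      = \sum_c value_at s (Pf a c * S b c).
    by apply: eq_bigr => c _; rewrite evalM -PfE -SE.
  have -> : \sum_c \sum_d W i x [tuple b] [tuple a; c; d]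
        * sigma i x [tuple c; d] [tuple]
      = \sum_c value_at s (\sum_e Wf a c b e * S c e).
    apply: eq_bigr => c _; rewrite eval_sum; apply: eq_bigr => d _.
    by rewrite evalM -WfE -SE.
  ring.
- have := prolongation_rho (@d_M _ _ _ i) Gsym dC SX Ssym nk Psym ricP tr0 a.
  rewrite -FE FC (pd_natl (@d_M _ _ _ i)) => /(congr1 (value_at s)).
  (* After evaluation the identity lives in a field, where the factor $n-1$ cancels. *)
  rewrite !evalM !eval_nat => /(mulfI k_neq0).
  rewrite -(represents_d a rhoE) evalB !evalM !eval_nat !eval_sum /= => E.
  rewrite /tractor_nabla_rho /=; apply: (mulfI n_neq0).
  move: (partial i a rho x) E => r E.
  rewrite mulr0 !(mulrBr, mulrDr) E.
  have -> : \sum_b P i x [tuple] [tuple a; b] * mu i x [tuple b] [tuple]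
      = \sum_b value_at s (Pf a b * X b).
    by apply: eq_bigr => b _; rewrite evalM -PfE -XE.
  have -> : \sum_b \sum_c cotton_york D P i x a b c
        * sigma i x [tuple b; c] [tuple]
    = 2^-1 * \sum_b value_at s (\sum_c (cov02 d_ (Gam D i) Pf a b c
         - cov02 d_ (Gam D i) Pf b a c) * S b c).
    rewrite mulr_sumr; apply: eq_bigr => b _.
    rewrite eval_sum mulr_sumr; apply: eq_bigr => c _.
    by rewrite evalM evalB -!(nabla02E D PfE) -SE /cotton_york mulrA.
  by field.
Qed.

Lemma prolongation_exists : exists2 s : tractor M,
  tractor_section s /\ covariant_constant D P W s & sigma_of s = sigma.
Proof.
exists (Tractor sigma mu rho) => //; split.
  by split => // i; have [] := prolongation_in_chart i.
by move=> i; have [_] := prolongation_in_chart i.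
Qed.

End surjectivity.

Lemma tractor_determined (P : tensor M 0 2) (W : tensor M 1 3) (s t : tractor M) :
  (0 < n)%N ->
  tractor_section s -> covariant_constant D P W s ->
  tractor_section t -> covariant_constant D P W t ->
  sigma_of s = sigma_of t -> s = t.
Proof.
case: s t => sigma mu rho [sigma' mu' rho'] n_gt0 /= [_ tmu _] cs [_ tmu' _] ct E.
subst sigma'; rewrite /= in tmu tmu'.
have n_neq0 : n%:R != 0 :> R by rewrite pnatr_eq0 -lt0n.
have mu_eq : mu = mu'.
  apply/funext => i; apply/funext => x; apply/funext => u; apply/funext => v.
  (* Off the domain both fields are zero by convention, so they agree as functions and not only on
     charts. *)
  have [ix|nix] := pselect (dom i x); last first.
    by case: tmu => _ _ ->//; case: tmu' => _ _ ->.
  have -> : v = [tuple] by exact: tuple0.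
  have -> : u = [tuple thead u].
    by apply/val_inj; case: u => [[|c []]].
  have [Es _ _] := cs i x ix; have [Et _ _] := ct i x ix.
  have n1 : n.+1%:R != 0 :> R by rewrite pnatr_eq0.
  (* The trace of the first tractor equation expresses $(n+1)\mu$ through $\sigma$ alone. *)
  apply: (mulfI n1); rewrite !(@metrizability_trace sigma _ i x) //.
    by move=> a b c; have := Et a b c; rewrite /tractor_nabla_sigma /= => H; lra.
  by move=> a b c; have := Es a b c; rewrite /tractor_nabla_sigma /= => H; lra.
subst mu'; congr Tractor; apply/funext => x.
have [i ix] := dom_cover x.
have [_ Es _] := cs i x ix; have [_ Et _] := ct i x ix.
(* In a diagonal component of the second equation $\rho$ has coefficient $-1$, so one such component
   determines it from $\sigma$ and $\mu$. *)
pose a : 'I_n := Ordinal n_gt0.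
have := Es a a; have := Et a a; rewrite /tractor_nabla_mu /delta (eqxx a) /=.
by move=> H1 H2; lra.
Qed.

End prolongation.

Theorem theorem3p1 (R : realType) (n : nat) (hn : (2 <= n)%N)
    (M : oriented_manifold R n) (D : connection M)
    (D_torsion_free : torsion_free D) (D_special : special D)
    (P : tensor M 0 2) (P_schouten : is_schouten D P)
    (W : tensor M 1 3) (W_weyl : is_weyl D P W) :
  set_bij
    [set s : tractor M | tractor_section s /\ covariant_constant D P W s]
    [set sigma : tensor M 2 0 |
       symmetric_bivector sigma /\ metrizability_equation D sigma]
    (fun s : tractor M => sigma_of s).
Proof.
split.
- move=> s [[sym tmu srho] cc]; split=> //; exists (mu_of s) => // i x ix a b c.
  have [E _ _] := cc i x ix; have := E a b c; rewrite /tractor_nabla_sigma.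
  by move=> H; lra.
- move=> s t /set_mem[ts cs] /set_mem[tt ct].
  exact: tractor_determined (ltnW hn) ts cs tt ct.
- move=> sigma [sym [mu tmu metr]].
  have [s sP sE] := prolongation_exists hn D_torsion_free D_special P_schouten
    W_weyl sym tmu metr.
  by exists s.
Qed.
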